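(* Let $\mathcal{H}$ be a quasitriangular Hopf algebra with universal R-matrix $\mathcal{R}$. Then every left $\mathcal{H}^{op}\otimes\mathcal{H}$-module algebra is twist-equivalent to a left $\mathcal{H}\overset{\mathcal{R}}{\otimes}\mathcal{H}$-module algebra; that is, there is a twisting cocycle $\mathcal{F}$ for $\mathcal{H}^{op}\otimes\mathcal{H}$ such that the twist of the Hopf algebra $\mathcal{H}^{op}\otimes\mathcal{H}$ by $\mathcal{F}$ is $\mathcal{H}\overset{\mathcal{R}}{\otimes}\mathcal{H}$, and consequently for each left $\mathcal{H}^{op}\otimes\mathcal{H}$-module algebra $\mathcal{A}$ the twisted algebra $\tilde{\mathcal{A}}\stackrel{\mathcal{F}}{\sim}\mathcal{A}$ is an $\mathcal{H}\overset{\mathcal{R}}{\otimes}\mathcal{H}$-module algebra.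
   Context: Conventions: $\mathbb{K}$ is a commutative algebra over a field of zero characteristic and Hopf algebras are over $\mathbb{K}$, with coproduct $\Delta$, counit $\varepsilon$, antipode $\gamma$. In the infinite dimensional case all algebras are assumed complete in some topology (e.g. $h$-adic) and tensor products are completed. Summation is implicit: $\Delta(x)=x_{(1)}\otimes x_{(2)}$, $\mathcal{R}=\mathcal{R}_1\otimes\mathcal{R}_2$; numerical subscripts indicate tensor legs. $\mathcal{H}$ is quasitriangular with universal R-matrix $\mathcal{R}\in\mathcal{H}^{\otimes 2}$ (invertible) if $(\Delta\otimes\mathrm{id})(\mathcal{R})=\mathcal{R}_{13}\mathcal{R}_{23}$, $(\mathrm{id}\otimes\Delta)(\mathcal{R})=\mathcal{R}_{13}\mathcal{R}_{12}$, $\mathcal{R}\Delta(x)=\Delta^{op}(x)\mathcal{R}$ for all $x\in\mathcal{H}$. $\mathcal{H}^{op}$ is the coopposite Hopf algebra: the same algebra with coproduct $\Delta^{op}=\tau\circ\Delta$, $\tau$ the flip. Twist: for a Hopf algebra $\mathcal{B}$, a twisting cocycle is an invertible $\mathcal{F}=\mathcal{F}_1\otimes\mathcal{F}_2\in\mathcal{B}\otimes\mathcal{B}$ with $(\Delta\otimes\mathrm{id})(\mathcal{F})\mathcal{F}_{12}=(\mathrm{id}\otimes\Delta)(\mathcal{F})\mathcal{F}_{23}$ and $(\varepsilon\otimes\mathrm{id})(\mathcal{F})=1\otimes1=(\mathrm{id}\otimes\varepsilon)(\mathcal{F})$. The twist $\tilde{\mathcal{B}}\stackrel{\mathcal{F}}{\sim}\mathcal{B}$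 is the Hopf algebra with the same multiplication and counit and coproduct $\tilde\Delta(x)=\mathcal{F}^{-1}\Delta(x)\mathcal{F}$. If $\mathcal{A}$ is a left $\mathcal{B}$-module algebra with multiplication $m$ (so $x\triangleright(ab)=(x_{(1)}\triangleright a)(x_{(2)}\triangleright b)$, $x\triangleright1=\varepsilon(x)1$), then $\tilde{\mathcal{A}}\stackrel{\mathcal{F}}{\sim}\mathcal{A}$ is the same module with multiplication $\tilde m(a\otimes b)=m(\mathcal{F}_1\triangleright a\otimes\mathcal{F}_2\triangleright b)$; it is a left $\tilde{\mathcal{B}}$-module algebra, and $\tilde{\mathcal{A}}$, $\mathcal{A}$ are called twist-equivalent. The twisted tensor square $\mathcal{H}\overset{\mathcal{R}}{\otimes}\mathcal{H}$ is the twist of the ordinary tensor product Hopf algebra $\mathcal{H}\otimes\mathcal{H}$ by the cocycle $\mathcal{R}_{23}=(1\otimes\mathcal{R}_1)\otimes(\mathcal{R}_2\otimes1)\in(\mathcal{H}\otimes\mathcal{H})\otimes(\mathcal{H}\otimes\mathcal{H})$. *)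

(* Defs.v *)
(* MathComp, with the classical logic of mathcomp-classical. *)
From HB Require Import structures.
From mathcomp Require Import all_boot all_order all_algebra.
From mathcomp Require Import boolp classical_sets.
From mathcomp Require Import freeg.

Set Implicit Arguments.
Unset Strict Implicit.
Unset Printing Implicit Defensive.

Import GRing.Theory.
Local Open Scope ring_scope.
Local Open Scope classical_set_scope.

(******************************************************************************)
(*  Algebras "complete in some topology" are rendered with linear topologies: *)
(*  the ground ring K is a complete linearly topologized ring, and all        *)
(*  modules are complete Hausdorff linearly topologized K-modules. With all   *)
(*  topologies discrete there is nothing to complete and one gets arbitrary   *)
(*  K-modules with the algebraic tensor product; with K = k[[h]] and h-adic   *)
(*  topologies one gets the h-adically completed tensor product.              *)
(******************************************************************************)

Section LinearTopology.
Context {R : comNzRingType}.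

Definition submodule {M : lmodType R} (U : set M) : Prop :=
  U 0 /\ forall (a : R) (x y : M), U x -> U y -> U (a *: x + y).

(* A linear topology is determined by its open submodules. *)
Record linear_top (M : lmodType R) := LinearTop {
  opensub :> set M -> Prop;
  opensub_submodule : forall U, opensub U -> submodule U;
  opensubT : opensub setT;
  opensubI : forall U V, opensub U -> opensub V -> opensub (U `&` V);
  opensubS : forall U V,
    opensub U -> submodule V -> U `<=` V -> opensub V
}.

Definition compatible_family {M : lmodType R} (tau : linear_top M)
    (c : set M -> M) : Prop :=
  forall U V, tau U -> tau V -> U `<=` V -> V (c U - c V).

(* M -> lim_U M/U is bijective: tau is complete (existence) and Hausdorff
   (uniqueness). *)
Definition complete_hausdorff {M : lmodType R} (tau : linear_top M) : Prop :=
  forall c, compatible_family tau c ->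
    exists! x, forall U, tau U -> U (x - c U).

End LinearTopology.

Arguments linear_top {R} M.

Record ctopring (K : comNzRingType) := CTopRing {
  ktop :> linear_top (K^o : lmodType K);
  ktop_complete : complete_hausdorff ktop
}.

Record ctmod (K : comNzRingType) (KT : ctopring K) := CTMod {
  ctmod_car :> lmodType K;
  mtop : linear_top ctmod_car;
  mtop_complete : complete_hausdorff mtop;
  mtop_scale : forall W, mtop W ->
    exists2 I, KT I & forall (a : K) (x : ctmod_car), I a -> W (a *: x)
}.

Section DiscreteTopology.
Context {R : comNzRingType} (M : lmodType R).

Definition discrete_top : linear_top M.
Proof.
apply: (@LinearTop _ M submodule) => //.
by move=> U V sU sV; split=> [|a x y [? ?] [? ?]]; split;
  [case: sU|case: sV|apply: sU.2|apply: sV.2].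
Defined.

Lemma discrete_open0 : discrete_top [set 0].
Proof. by split=> // a x y /= -> ->; rewrite scaler0 addr0. Qed.

Lemma discrete_complete : complete_hausdorff discrete_top.
Proof.
move=> c cc; exists (c [set 0]); split=> [U oU|y /(_ _ discrete_open0)/= /eqP].
  by apply: cc => //; [apply: discrete_open0|move=> _ ->; case: oU].
by rewrite subr_eq0 => /eqP.
Qed.

End DiscreteTopology.

Definition discrete_ctopring (K : comNzRingType) : ctopring K :=
  CTopRing (@discrete_complete K K^o).

Lemma discrete_scale (K : comNzRingType) (M : lmodType K) W :
  discrete_top M W -> exists2 I, discrete_ctopring K I &
    forall (a : K) (x : M), I a -> W (a *: x).
Proof.
move=> oW; exists [set 0]; first exact: discrete_open0.
by move=> a x /= ->; rewrite scale0r; case: oW.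
Qed.

Definition discrete_ctmod (K : comNzRingType) (M : lmodType K) :
    ctmod (discrete_ctopring K) :=
  CTMod (@discrete_complete K M) (@discrete_scale K M).

Section SubmoduleTheory.
Context {R : comNzRingType} {M : lmodType R} (U : set M).
Hypothesis subU : submodule U.

Lemma submod0 : U 0. Proof. by case: subU. Qed.

Lemma submodD x y : U x -> U y -> U (x + y).
Proof. by move=> Ux Uy; rewrite -[x]scale1r; apply: subU.2. Qed.

Lemma submodZ a x : U x -> U (a *: x).
Proof. by move=> Ux; rewrite -[_ *: x]addr0; apply: subU.2 => //; case: subU. Qed.

Lemma submodN x : U x -> U (- x).
Proof. by move=> Ux; rewrite -scaleN1r; apply: submodZ. Qed.

Lemma submodB x y : U x -> U y -> U (x - y).
Proof. by move=> Ux Uy; apply: submodD => //; apply: submodN. Qed.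

Lemma submodBC x y : U (x - y) -> U (y - x).
Proof. by move=> /submodN; rewrite opprB. Qed.

Lemma submod_trans y x z : U (x - y) -> U (y - z) -> U (x - z).
Proof. by move=> Uxy Uyz; rewrite -(subrKA y); apply: submodD. Qed.

End SubmoduleTheory.

Lemma linear_fun0 {R : comNzRingType} {M N : lmodType R} (f : M -> N) :
  linear f -> f 0 = 0.
Proof. by move=> lf; have := lf (-1) 0 0; rewrite scaler0 addr0 scaleN1r addNr. Qed.

Lemma linear_funB {R : comNzRingType} {M N : lmodType R} (f : M -> N) x y :
  linear f -> f (x - y) = f x - f y.
Proof. by move=> lf; rewrite -scaleN1r addrC lf scaleN1r addrC. Qed.

Lemma submodule_preimage {R : comNzRingType} {M N : lmodType R} (f : M -> N) U :
  linear f -> submodule U -> submodule (f @^-1` U).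
Proof.
move=> lf sU; split=> [|a x y] /=; first by rewrite linear_fun0 //; apply: submod0.
by rewrite lf; apply: sU.2.
Qed.

(* The completion lim_W F/W of a linearly topologized module F. Its elements
   are represented by compatible families of elements of F, each of which is
   the chosen representative of its class modulo W. *)
Section Completion.
Context {R : comNzRingType} {F : lmodType R} (tau : linear_top F).

Let subW W : tau W -> submodule W := @opensub_submodule _ _ tau W.

Definition class_rep (W : set F) (x : F) : F :=
  if pselect (tau W) then xget 0 [set y | W (x - y)] else 0.

Record completion := Completion {
  comp_fun :> set F -> F;
  comp_rep : forall W, class_rep W (comp_fun W) = comp_fun W;
  comp_compat : compatible_family tau comp_fun
}.

HB.instance Definition _ := gen_eqMixin completion.
HB.instance Definition _ := gen_choiceMixin completion.

Lemma class_repP W x : tau W -> W (x - class_rep W x).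
Proof.
move=> oW; rewrite /class_rep; case: pselect => [_|//] /=.
have : [set y | W (x - y)] x by rewrite /= subrr; apply: submod0 (subW oW).
by move=> /(xgetI 0).
Qed.

Lemma class_rep_eq W x y :
  (tau W -> W (x - y)) -> class_rep W x = class_rep W y.
Proof.
rewrite /class_rep; case: pselect => /= [oW|//] /(_ oW) Wxy.
congr xget; apply/predeqP => z /=; split=> Wz.
  exact: (submod_trans (subW oW) (submodBC (subW oW) Wxy) Wz).
exact: (submod_trans (subW oW) Wxy Wz).
Qed.

Lemma comp_eqP (s t : completion) : (forall W, tau W -> W (s W - t W)) -> s = t.
Proof.
case: s t => [s rs cs] [t rt ct] /= est.
have e : s = t by apply/funext => W; rewrite -rs -rt; apply: class_rep_eq => oW; apply: est.
by subst t; congr Completion; apply: Prop_irrelevance.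
Qed.

Section Mk.
Variable (c : set F -> F) (cc : compatible_family tau c).

Let mk_rep W : class_rep W (class_rep W (c W)) = class_rep W (c W).
Proof. by apply: class_rep_eq => oW; apply: (submodBC (subW oW)); apply: class_repP. Qed.

Let mk_compat : compatible_family tau (fun W => class_rep W (c W)).
Proof.
move=> U V oU oV UV; have sV := subW oV.
apply: (submod_trans sV (y := c V)); last exact: class_repP.
apply: (submod_trans sV (y := c U)); last exact: cc.
by apply: (submodBC sV); apply: UV; apply: class_repP.
Qed.

Definition mk_comp := Completion mk_rep mk_compat.

Lemma mk_compE W : tau W -> W (mk_comp W - c W).
Proof. by move=> oW; apply: (submodBC (subW oW)); apply: class_repP. Qed.

End Mk.

Lemma compat_const x : compatible_family tau (fun=> x).
Proof. by move=> U V _ oV _; rewrite subrr; apply: submod0 (subW oV). Qed.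

Lemma compat_add (s t : completion) : compatible_family tau (fun W => s W + t W).
Proof.
move=> U V oU oV UV; rewrite opprD addrACA.
by apply: (submodD (subW oV)); apply: comp_compat.
Qed.

Lemma compat_opp (s : completion) : compatible_family tau (fun W => - s W).
Proof.
move=> U V oU oV UV; rewrite -opprD.
by apply: (submodN (subW oV)); apply: comp_compat.
Qed.

Lemma compat_scale a (s : completion) : compatible_family tau (fun W => a *: s W).
Proof.
move=> U V oU oV UV; rewrite -scalerBr.
by apply: (submodZ (subW oV)); apply: comp_compat.
Qed.

(* the canonical map F -> completion *)
Definition comp_emb x := mk_comp (compat_const x).
Definition comp_add s t := mk_comp (compat_add s t).
Definition comp_opp s := mk_comp (compat_opp s).
Definition comp_scale a s := mk_comp (compat_scale a s).

Lemma comp_addE s t W : tau W -> W (comp_add s t W - (s W + t W)).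
Proof. exact: mk_compE. Qed.
Lemma comp_oppE s W : tau W -> W (comp_opp s W - (- s W)).
Proof. exact: mk_compE. Qed.
Lemma comp_scaleE a s W : tau W -> W (comp_scale a s W - a *: s W).
Proof. exact: mk_compE. Qed.

Let eq_of (s : completion) (x : set F -> F) :=
  forall W, tau W -> W (s W - x W).

Let eq_ofP s t x : eq_of s x -> eq_of t x -> s = t.
Proof.
move=> sx tx; apply: comp_eqP => W oW.
exact: (submod_trans (subW oW) (sx W oW) (submodBC (subW oW) (tx W oW))).
Qed.

Let eq_of_id s : eq_of s s.
Proof. by move=> W oW; rewrite subrr; apply: submod0 (subW oW). Qed.

Let eq_of_add s t x y :
  eq_of s x -> eq_of t y -> eq_of (comp_add s t) (fun W => x W + y W).
Proof.
move=> sx ty W oW; apply: (submod_trans (subW oW) (comp_addE _ _ oW)).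
by rewrite opprD addrACA; apply: (submodD (subW oW)); [apply: sx|apply: ty].
Qed.

Let eq_of_scale a s x :
  eq_of s x -> eq_of (comp_scale a s) (fun W => a *: x W).
Proof.
move=> sx W oW; apply: (submod_trans (subW oW) (comp_scaleE _ _ oW)).
by rewrite -scalerBr; apply: (submodZ (subW oW)); apply: sx.
Qed.

Let eq_of_opp s x : eq_of s x -> eq_of (comp_opp s) (fun W => - x W).
Proof.
move=> sx W oW; apply: (submod_trans (subW oW) (comp_oppE _ oW)).
by rewrite -opprD; apply: (submodN (subW oW)); apply: sx.
Qed.

Let eq_of_ext s x y : eq_of s x -> x =1 y -> eq_of s y.
Proof. by move=> sx xy W oW; rewrite -xy; apply: sx. Qed.

Let eq_of_emb x : eq_of (comp_emb x) (fun=> x).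
Proof. by move=> W; apply: mk_compE. Qed.

Lemma comp_addA : associative comp_add.
Proof.
move=> s t r; apply: (eq_ofP (x := fun W => s W + (t W + r W))).
  by do 2! [apply: eq_of_add; first exact: eq_of_id]; exact: eq_of_id.
apply: (@eq_of_ext _ (fun W => s W + t W + r W)); last by move=> W; rewrite addrA.
by do 2! [apply: eq_of_add; last exact: eq_of_id]; exact: eq_of_id.
Qed.

Lemma comp_addC : commutative comp_add.
Proof.
move=> s t; apply: (eq_ofP (x := fun W => s W + t W)); first exact: eq_of_add.
apply: (@eq_of_ext _ (fun W => t W + s W)); last by move=> W; rewrite addrC.
exact: eq_of_add.
Qed.

Lemma comp_add0 : left_id (comp_emb 0) comp_add.
Proof.
move=> s; apply: (eq_ofP (x := fun W => 0 + s W)).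
  by apply: eq_of_add => //; apply: eq_of_emb.
by apply: (@eq_of_ext _ s) => // W; rewrite add0r.
Qed.

Lemma comp_addN : left_inverse (comp_emb 0) comp_opp comp_add.
Proof.
move=> s; apply: (eq_ofP (x := fun W => - s W + s W)).
  by apply: eq_of_add => //; apply: eq_of_opp.
by apply: (@eq_of_ext _ (fun=> 0)) => // W; rewrite addNr.
Qed.

HB.instance Definition _ :=
  GRing.isZmodule.Build completion comp_addA comp_addC comp_add0 comp_addN.

Lemma comp_scaleA a b s : comp_scale a (comp_scale b s) = comp_scale (a * b) s.
Proof.
apply: (eq_ofP (x := fun W => a *: (b *: s W))).
  by do 2! apply: eq_of_scale.
apply: (@eq_of_ext _ (fun W => (a * b) *: s W)); last by move=> W; rewrite scalerA.
exact: eq_of_scale.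
Qed.

Lemma comp_scale1 s : comp_scale 1 s = s.
Proof.
apply: (eq_ofP (x := fun W => 1 *: s W)); first exact: eq_of_scale.
by apply: (@eq_of_ext _ s) => // W; rewrite scale1r.
Qed.

Lemma comp_scaleDr a s t :
  comp_scale a (s + t) = comp_scale a s + comp_scale a t.
Proof.
apply: (eq_ofP (x := fun W => a *: (s W + t W))).
  by apply: eq_of_scale; apply: eq_of_add.
apply: (@eq_of_ext _ (fun W => a *: s W + a *: t W)).
  by apply: eq_of_add; apply: eq_of_scale.
by move=> W; rewrite scalerDr.
Qed.

Lemma comp_scaleDl s a b :
  comp_scale (a + b) s = comp_scale a s + comp_scale b s.
Proof.
apply: (eq_ofP (x := fun W => (a + b) *: s W)); first exact: eq_of_scale.
apply: (@eq_of_ext _ (fun W => a *: s W + b *: s W)).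
  by apply: eq_of_add; apply: eq_of_scale.
by move=> W; rewrite scalerDl.
Qed.

HB.instance Definition _ := GRing.Zmodule_isLmodule.Build R completion
  comp_scaleA comp_scale1 comp_scaleDr comp_scaleDl.

Lemma compD (s t : completion) W : tau W -> W ((s + t) W - (s W + t W)).
Proof. exact: comp_addE. Qed.
Lemma compN (s : completion) W : tau W -> W ((- s) W - (- s W)).
Proof. exact: comp_oppE. Qed.
Lemma compZ a (s : completion) W : tau W -> W ((a *: s) W - a *: s W).
Proof. exact: comp_scaleE. Qed.
Lemma comp_embE x W : tau W -> W (comp_emb x W - x).
Proof. exact: mk_compE. Qed.

Lemma compB (s t : completion) W : tau W -> W ((s - t) W - (s W - t W)).
Proof.
move=> oW; have sW := subW oW; apply: (submod_trans sW (compD _ _ oW)).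
by rewrite opprD addrACA subrr add0r; apply: compN.
Qed.

Lemma comp_emb_linear : linear comp_emb.
Proof.
move=> a x y; apply: (eq_ofP (x := fun=> a *: x + y)); first exact: eq_of_emb.
by apply: eq_of_add; [apply: eq_of_scale|]; apply: eq_of_emb.
Qed.

(* the closure of the image of W *)
Definition comp_nbhs (W : set F) : set completion := fun t => W (t W).

Lemma comp_nbhs_sub W : tau W -> submodule (comp_nbhs W).
Proof.
move=> oW; have sW := subW oW; split=> [|a s t Ws Wt]; rewrite /comp_nbhs.
  by have := comp_embE 0 oW; rewrite subr0.
rewrite -[X in W X](subrK ((a *: s) W + t W)).
apply: (submodD sW); first exact: compD.
apply: (submodD sW) => //; rewrite -[X in W X](subrK (a *: s W)).
by apply: (submodD sW); [apply: compZ|apply: (submodZ sW)].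
Qed.

Lemma comp_nbhsS U V : tau U -> tau V -> U `<=` V ->
  comp_nbhs U `<=` comp_nbhs V.
Proof.
move=> oU oV UV t Ut; rewrite /comp_nbhs -[X in V X](subrK (t U)).
have sV := subW oV; apply: (submodD sV); last exact: UV.
by apply: (submodBC sV); apply: comp_compat.
Qed.

Definition comp_open : set (set completion) :=
  [set O | submodule O /\ exists2 W, tau W & comp_nbhs W `<=` O].

Lemma comp_nbhs_open W : tau W -> comp_open (comp_nbhs W).
Proof. by move=> oW; split; [apply: comp_nbhs_sub|exists W]. Qed.

Lemma comp_open_sub O : comp_open O -> submodule O. Proof. by case. Qed.

Lemma comp_openT : comp_open setT.
Proof. by split; [split|exists setT => //; apply: opensubT]. Qed.

Lemma comp_openI O O' : comp_open O -> comp_open O' -> comp_open (O `&` O').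
Proof.
move=> [sO [W oW WO]] [sO' [W' oW' WO']]; split.
  split=> [|a x y [Ox O'x] [Oy O'y]]; first by split; apply: submod0.
  by split; [apply: sO.2|apply: sO'.2].
have oI := opensubI oW oW'.
exists (W `&` W') => // t It; split.
  by apply: WO; apply: (comp_nbhsS oI oW) It => ? [].
by apply: WO'; apply: (comp_nbhsS oI oW') It => ? [].
Qed.

Lemma comp_openS O O' :
  comp_open O -> submodule O' -> O `<=` O' -> comp_open O'.
Proof. by move=> [_ [W oW WO]] sO' OO'; split=> //; exists W => // t /WO/OO'. Qed.

Definition comp_top : linear_top completion :=
  LinearTop comp_open_sub comp_openT comp_openI comp_openS.

Lemma comp_top_complete : complete_hausdorff comp_top.
Proof.
move=> c cc.
have ccW : compatible_family tau (fun W => c (comp_nbhs W) W).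
  move=> U V oU oV UV; have sV := subW oV.
  apply: (submod_trans sV (y := c (comp_nbhs U) V)); first exact: comp_compat.
  have := cc _ _ (comp_nbhs_open oU) (comp_nbhs_open oV) (comp_nbhsS oU oV UV).
  rewrite /comp_nbhs => Vd.
  rewrite -[X in V X](subrK ((c (comp_nbhs U) - c (comp_nbhs V)) V)).
  by apply: (submodD sV) => //; apply: (submodBC sV); apply: compB.
have xP W : tau W -> comp_nbhs W (mk_comp ccW - c (comp_nbhs W)).
  move=> oW; have sW := subW oW; rewrite /comp_nbhs.
  rewrite -[X in W X](subrK (mk_comp ccW W - c (comp_nbhs W) W)).
  by apply: (submodD sW); [apply: compB|apply: mk_compE].
exists (mk_comp ccW); split=> [O [sO [W oW WO]]|y yP].
  apply: (submod_trans sO (y := c (comp_nbhs W))); first by apply: WO; apply: xP.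
  by apply: cc => //; [apply: comp_nbhs_open|split=> //; exists W].
apply: comp_eqP => W oW; have sW := subW oW; have sN := comp_nbhs_sub oW.
have := submod_trans sN (xP W oW) (submodBC sN (yP _ (comp_nbhs_open oW))).
rewrite /comp_nbhs => Wd; rewrite -[X in W X](subrK ((mk_comp ccW - y) W)).
by apply: (submodD sW) => //; apply: (submodBC sW); apply: compB.
Qed.

End Completion.

(* Continuous K-linear and K-bilinear maps; the latter are those which induce
   continuous maps on the tensor product. *)
Section ContinuousMaps.
Context {K : comNzRingType} {KT : ctopring K}.

Definition clinear {M P : ctmod KT} (f : M -> P) : Prop :=
  linear f /\ forall W, mtop P W -> mtop M (f @^-1` W).

Definition cbilinear {M N P : ctmod KT} (f : M -> N -> P) : Prop :=
  [/\ forall y, linear (f^~ y), forall x, linear (f x) &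
   forall W, mtop P W -> exists U V, [/\ mtop M U, mtop N V,
     forall x y, U x -> W (f x y) & forall x y, V y -> W (f x y)]].

End ContinuousMaps.

Lemma discrete_cbilinear (K : comNzRingType) (M N P : lmodType K)
    (f : discrete_ctmod M -> discrete_ctmod N -> discrete_ctmod P) :
  (forall y, linear (f^~ y)) -> (forall x, linear (f x)) -> cbilinear f.
Proof.
move=> fl fr; split=> // W sW; exists [set 0], [set 0].
split; [exact: discrete_open0|exact: discrete_open0| |] => x y /= ->.
  by rewrite (linear_fun0 (fl y)); case: sW.
by rewrite (linear_fun0 (fr x)); case: sW.
Qed.

(* The completed tensor product: the completion of the free module on M * N
   for the submodules W which contain the bilinearity relations as well as
   U x N and M x V for some open submodules U and V. *)
Section CompletedTensorProduct.
Context {K : comNzRingType} {KT : ctopring K} (M N : ctmod KT).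

Let F : lmodType K := {freeg (M * N)%type / K}.
Let gen (x : M) (y : N) : F := << (x, y) >>.

Definition tens_open : set (set F) := [set W | submodule W /\
  [/\ forall (a : K) x x' y, W (gen (a *: x + x') y - (a *: gen x y + gen x' y)),
      forall (a : K) x y y', W (gen x (a *: y + y') - (a *: gen x y + gen x y')) &
   exists U V, [/\ mtop M U, mtop N V,
     forall x y, U x -> W (gen x y) & forall x y, V y -> W (gen x y)]]].

Lemma tens_open_sub W : tens_open W -> submodule W. Proof. by case. Qed.

Lemma tens_openT : tens_open setT.
Proof.
by do 2 split=> //; exists setT, setT; split=> //; apply: opensubT.
Qed.

Lemma tens_openI W W' : tens_open W -> tens_open W' -> tens_open (W `&` W').
Proof.
move=> [sW [l r [U [V [oU oV hU hV]]]]] [sW' [l' r' [U' [V' [oU' oV' hU' hV']]]]].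
split; [|split].
- split=> [|a x y [Wx W'x] [Wy W'y]]; first by split; apply: submod0.
  by split; [apply: sW.2|apply: sW'.2].
- by move=> *; split; [apply: l|apply: l'].
- by move=> *; split; [apply: r|apply: r'].
exists (U `&` U'), (V `&` V'); split; [exact: opensubI|exact: opensubI| |].
  by move=> x y [Ux U'x]; split; [apply: hU|apply: hU'].
by move=> x y [Vy V'y]; split; [apply: hV|apply: hV'].
Qed.

Lemma tens_openS W W' :
  tens_open W -> submodule W' -> W `<=` W' -> tens_open W'.
Proof.
move=> [sW [l r [U [V [oU oV hU hV]]]]] sW' WW'.
split=> //; split.
- by move=> *; apply: WW'; apply: l.
- by move=> *; apply: WW'; apply: r.
by exists U, V; split=> // x y h; apply: WW'; [apply: hU|apply: hV].
Qed.

Definition tens_top : linear_top F :=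
  LinearTop tens_open_sub tens_openT tens_openI tens_openS.

Lemma freeg_span (W : set F) : submodule W -> (forall x y, W (gen x y)) ->
  forall r, W r.
Proof.
move=> sW Wg; apply: freeg_ind_dom0 => [|a [x y] D _ _ WD]; first exact: submod0.
have -> : << a *g (x, y) >> = a *: gen x y.
  by apply/eqP; apply/freeg_eqP => w; rewrite coeffZ !coeffU mul1r.
exact: sW.2.
Qed.

Lemma ctens_scale W : comp_top tens_top W ->
  exists2 I, KT I &
    forall (a : K) (t : completion tens_top), I a -> W (a *: t).
Proof.
move=> [sW [V oV VW]]; have sV := opensub_submodule oV.
have [_ [l _ [U [_ [oU _ hU _]]]]] := oV.
have [I oI IU] := mtop_scale oU; exists I => // a t Ia; apply: VW.
rewrite /comp_nbhs -[X in V X](subrK (a *: t V)).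
apply: (submodD sV); first exact: compZ.
apply: (freeg_span (W := [set r | V (a *: r)])) => [|x y] /=.
  split=> [|b r s Vr Vs] /=; first by rewrite scaler0; apply: submod0.
  by rewrite scalerDr scalerA mulrC -scalerA; apply: sV.2.
have -> : a *: gen x y = gen (a *: x + 0) y
    - (gen (a *: x + 0) y - (a *: gen x y + gen 0 y)) - gen 0 y.
  by rewrite subKr addrK.
apply: (submodB sV); last by apply: hU; apply: submod0 (opensub_submodule oU).
by apply: (submodB sV); [rewrite addr0; apply: hU; apply: IU|apply: l].
Qed.

Definition ctens : ctmod KT := CTMod (@comp_top_complete _ _ tens_top) ctens_scale.

Definition pure (x : M) (y : N) : ctens := comp_emb tens_top (gen x y).

Lemma pure_cbilinear : cbilinear pure.
Proof.
have lin a x y z : (forall W, tens_open W -> W (x - (a *: y + z))) ->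
    comp_emb tens_top x = a *: comp_emb tens_top y + comp_emb tens_top z.
  move=> h; rewrite -comp_emb_linear; apply: comp_eqP => W oW.
  have sW := opensub_submodule (l := tens_top) oW.
  apply: (submod_trans sW (comp_embE _ oW)).
  apply: (submod_trans sW (h _ oW)); apply: (submodBC sW); exact: comp_embE.
split.
- by move=> y a x x'; apply: lin => W [_ []].
- by move=> x a y y'; apply: lin => W [_ []].
move=> O [sO [W oW WO]]; have [sW [_ _ [U [V [oU oV hU hV]]]]] := oW.
exists U, V; split=> // x y h; apply: WO; rewrite /comp_nbhs.
  rewrite -[X in W X](subrK (gen x y)).
  by apply: (submodD sW); [apply: (comp_embE (tau := tens_top))|apply: hU].
rewrite -[X in W X](subrK (gen x y)).
by apply: (submodD sW); [apply: (comp_embE (tau := tens_top))|apply: hV].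
Qed.

(* The continuous linear map induced by a continuous bilinear map f; in
   Sweedler notation, tlift f t is f t_1 t_2. *)
Definition tlift {P : ctmod KT} (f : M -> N -> P) : ctens -> P :=
  xget (fun=> 0) [set g | clinear g /\ forall x y, g (pure x y) = f x y].

Lemma clinear_submodule {P Q : ctmod KT} (g g' : P -> Q) :
  clinear g -> clinear g' -> forall W, mtop Q W -> submodule [set x | W (g x - g' x)].
Proof.
move=> [lg _] [lg' _] W oW; have sW := opensub_submodule oW; split=> [|a x y] /=.
  by rewrite (linear_fun0 lg) (linear_fun0 lg') subrr; apply: submod0.
rewrite lg lg' opprD addrACA -scalerBr; exact: sW.2.
Qed.

Lemma ctmod_eqP {P : ctmod KT} (x y : P) :
  (forall W, mtop P W -> W (x - y)) -> x = y.
Proof.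
move=> h; have cy : compatible_family (mtop P) (fun=> y).
  by move=> U V _ oV _; rewrite subrr; apply: submod0 (opensub_submodule oV).
have [z [_ uz]] := mtop_complete cy.
have <- : z = x by apply: uz => U; apply: h.
by apply: uz => U oU; rewrite subrr; apply: submod0 (opensub_submodule oU).
Qed.

(* pure tensors are topologically generating *)
Lemma ctens_ext {P : ctmod KT} (g g' : ctens -> P) : clinear g -> clinear g' ->
  (forall x y, g (pure x y) = g' (pure x y)) -> g =1 g'.
Proof.
move=> cg cg' gg' t; apply: ctmod_eqP => W oW; have sW := opensub_submodule oW.
have [sO1 [V1 oV1 h1]] := cg.2 _ oW; have [sO2 [V2 oV2 h2]] := cg'.2 _ oW.
have oV := opensubI oV1 oV2; set V := V1 `&` V2 in oV.
pose s : ctens := comp_emb tens_top (t V).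
have tsV : comp_nbhs V (t - s).
  have sV := opensub_submodule oV.
  rewrite /comp_nbhs -[X in V X](subrK (t V - s V)).
  apply: (submodD sV); first exact: (compB _ _ oV).
  by apply: (submodBC sV); apply: comp_embE.
have sE := clinear_submodule cg cg' oW.
suff Es : W (g s - g' s).
  have -> : t = 1 *: (t - s) + s by rewrite scale1r subrK.
  apply: sE.2 => //=; apply: (submodB sW).
    by apply: h1; apply: (comp_nbhsS oV oV1) tsV => ? [].
  by apply: h2; apply: (comp_nbhsS oV oV2) tsV => ? [].
apply: (freeg_span (W := [set r | W (g (comp_emb tens_top r) - g' (comp_emb tens_top r))])).
  split=> [|a r r' Wr Wr'] /=.
    by have -> : comp_emb tens_top 0 = 0 :> ctens by []; apply: submod0 sE.
  by rewrite comp_emb_linear; apply: sE.2.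
by move=> x y /=; rewrite -/(pure x y) gg' subrr; apply: submod0.
Qed.

Lemma tlift_exists {P : ctmod KT} (f : M -> N -> P) : cbilinear f ->
  exists g : ctens -> P, clinear g /\ forall x y, g (pure x y) = f x y.
Proof.
move=> [fl fr fc]; pose f0 (r : F) : P := fglift (fun z => f z.1 z.2) r.
have f0B r r' : f0 (r - r') = f0 r - f0 r' by apply: lift_is_additive.
have f0D r r' : f0 (r + r') = f0 r + f0 r'.
  by rewrite -[r' in LHS]opprK f0B -[- r']sub0r !f0B -{1}[0]subr0 f0B subrr sub0r opprK.
have f0Z a r : f0 (a *: r) = a *: f0 r.
  have f00 : f0 0 = 0 by apply: (addrI (f0 0)); rewrite -f0D !addr0.
  elim/freeg_ind_dom0: r => [|b z D _ _ IH]; first by rewrite scaler0 f00 scaler0.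
  rewrite scalerDr !f0D IH scalerDr; congr (_ + _).
  have -> : a *: << b *g z >> = << a * b *g z >> :> F.
    by apply/eqP; apply/freeg_eqP => w; rewrite coeffZ !coeffU mulrA.
  by rewrite /f0 !liftU scalerA.
have f0gen x y : f0 (gen x y) = f x y by rewrite /f0 liftU scale1r.
have oP W : mtop P W -> tens_open [set r | W (f0 r)].
  move=> oW; have sW := opensub_submodule oW; split; last split=> /=.
  - split=> [|a r r' Wr Wr'] /=; last by rewrite f0D f0Z; apply: sW.2.
    by have := f0B 0 0; rewrite !subrr => ->; apply: submod0.
  - by move=> a x x' y; rewrite f0B f0D f0Z !f0gen fl subrr; apply: submod0.
  - by move=> a x y y'; rewrite f0B f0D f0Z !f0gen fr subrr; apply: submod0.
  have [U [V [oU oV hU hV]]] := fc _ oW; exists U, V; split=> // x y h.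
    by rewrite f0gen; apply: hU.
  by rewrite f0gen; apply: hV.
have cf (t : ctens) : compatible_family (mtop P) (fun W => f0 (t [set r | W (f0 r)])).
  move=> U V oU oV UV; rewrite -f0B.
  have := comp_compat t (oP _ oU) (oP _ oV); apply=> r /=; exact: UV.
have [g gP] := choice (fun t => mtop_complete (cf t)).
have gW t W : mtop P W -> W (g t - f0 (t [set r | W (f0 r)])) by apply: (gP t).1.
have lg : linear g.
  move=> a s t; apply: (gP _).2 => W oW; have sW := opensub_submodule oW.
  set V := [set r | W (f0 r)]; have oV : tens_open V := oP _ oW.
  have sV := opensub_submodule (l := tens_top) oV.
  have : V ((a *: s + t : ctens) V - (a *: s V + t V)).
    have := compD (a *: s : ctens) t (tau := tens_top) oV.
    move=> /(submod_trans sV); apply; rewrite opprD addrACA subrr addr0.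
    exact: (compZ a s (tau := tens_top) oV).
  rewrite /V /= f0B f0D f0Z -/V => h; apply: (submodBC sW).
  apply: (submod_trans sW h); rewrite opprD addrACA -scalerBr.
  by apply: sW.2; apply: (submodBC sW); apply: gW.
exists g; split; first split=> //.
  move=> W oW; have sW := opensub_submodule oW.
  split; first exact: submodule_preimage.
  exists [set r | W (f0 r)]; first exact: oP.
  move=> t; rewrite /comp_nbhs /= => h.
  rewrite -[X in W X](subrK (f0 (t [set r | W (f0 r)]))).
  by apply: (submodD sW); [apply: (gW t)|exact: h].
move=> x y; apply: (gP _).2 => W oW; rewrite -f0gen -f0B.
apply: (submodBC (opensub_submodule (l := tens_top) (oP _ oW))).
exact: (comp_embE (tau := tens_top) (gen x y) (oP _ oW)).
Qed.

Lemma tliftP {P : ctmod KT} (f : M -> N -> P) : cbilinear f ->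
  clinear (tlift f) /\ forall x y, tlift f (pure x y) = f x y.
Proof.
by move=> /tlift_exists[g gP]; rewrite /tlift; case: xgetP => [h _ //|/(_ g) []].
Qed.

End CompletedTensorProduct.

Arguments pure {K KT M N} x y.
Arguments tlift {K KT M N P} f t.

Notation "x \ox y" := (pure x y) (at level 40, left associativity).

Section TensorMaps.
Context {K : comNzRingType} {KT : ctopring K}.
Implicit Types M N P Q : ctmod KT.

Definition tmap {M N P Q} (f : M -> P) (g : N -> Q) : ctens M N -> ctens P Q :=
  tlift (fun x y => f x \ox g y).

Definition tflip {M N} : ctens M N -> ctens N M := tlift (fun x y => y \ox x).

Definition tassoc {M N P} : ctens (ctens M N) P -> ctens M (ctens N P) :=
  tlift (fun t z => tlift (fun x y => x \ox (y \ox z)) t).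

(* (M * N) * (P * Q) -> (M * P) * (N * Q), flipping the two middle factors *)
Definition tmidflip {M N P Q} :
    ctens (ctens M N) (ctens P Q) -> ctens (ctens M P) (ctens N Q) :=
  tlift (fun s t =>
    tlift (fun x y => tlift (fun z w => (x \ox z) \ox (y \ox w)) t) s).

End TensorMaps.

(* The structures below carry the operations only; the axioms are the
   predicates is_algebra, is_hopf, is_module_algebra. *)
Section Algebras.
Context {K : comNzRingType} (KT : ctopring K).

Record alg := Alg {
  alg_mod :> ctmod KT;
  amul : alg_mod -> alg_mod -> alg_mod;
  aone : alg_mod
}.

Definition is_algebra (A : alg) : Prop :=
  [/\ cbilinear (@amul A), associative (@amul A),
      left_id (aone A) (@amul A) & right_id (aone A) (@amul A)].

End Algebras.

Arguments amul {K KT A} x y : rename.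
Arguments aone {K KT A} : rename.

Declare Scope alg_scope.
Delimit Scope alg_scope with alg.
Local Open Scope alg_scope.
Notation "x ** y" := (amul x y) (at level 40, left associativity) : alg_scope.

Section TensorAlgebra.
Context {K : comNzRingType} {KT : ctopring K}.
Implicit Types A B : alg KT.

Definition tens_alg A B : alg KT := {|
  alg_mod := ctens A B;
  amul := fun s t =>
    tlift (fun a b => tlift (fun c d => (a ** c) \ox (b ** d)) t) s;
  aone := aone \ox aone
|}.

Definition is_inverse A (x y : A) : Prop := x ** y = aone /\ y ** x = aone.

Definition invertible A (x : A) : Prop := exists y, is_inverse x y.

(* meaningful for invertible x *)
Definition ainv A (x : A) : A := xget aone [set y | is_inverse x y].

Definition leg12 A (t : tens_alg A A) : tens_alg A (tens_alg A A) :=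
  tlift (fun x y => x \ox (y \ox aone)) t.

Definition leg13 A (t : tens_alg A A) : tens_alg A (tens_alg A A) :=
  tlift (fun x y => x \ox (aone \ox y)) t.

Definition leg23 A (t : tens_alg A A) : tens_alg A (tens_alg A A) := aone \ox t.

End TensorAlgebra.

Section HopfAlgebras.
Context {K : comNzRingType} (KT : ctopring K).

Lemma ctbase_scale W : KT W ->
  exists2 I, KT I & forall (a : K) (x : K^o), I a -> W (a *: x).
Proof.
move=> oW; exists W => // a x Wa; rewrite -[_ *: _]/(a * x) mulrC.
exact: (submodZ (opensub_submodule oW) x Wa).
Qed.

(* K as a module over itself *)
Definition ctbase : ctmod KT :=
  @CTMod _ KT (K^o : lmodType K) KT (@ktop_complete _ KT) ctbase_scale.

(* The antipode is uniquely determined by the other operations, and is hence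
   treated as a property (in is_hopf). *)
Record hopf := Hopf {
  hopf_alg :> alg KT;
  coprod : hopf_alg -> tens_alg hopf_alg hopf_alg;
  counit : hopf_alg -> ctbase
}.

End HopfAlgebras.

Arguments coprod {K KT H} x : rename.
Arguments counit {K KT H} x : rename.

Section HopfTheory.
Context {K : comNzRingType} {KT : ctopring K}.
Implicit Types H B : hopf KT.

(* Delta (x) id and id (x) Delta on H^(x)2, with values in H (x) (H (x) H) *)
Definition coprodl H (t : tens_alg H H) : tens_alg H (tens_alg H H) :=
  tassoc (tmap coprod id t).
Definition coprodr H (t : tens_alg H H) : tens_alg H (tens_alg H H) :=
  tmap id coprod t.

(* eps (x) id and id (x) eps, after identifying K (x) H and H (x) K with H *)
Definition counitl H (t : tens_alg H H) : H :=
  tlift (fun x y => (counit x : K) *: (y : H)) t.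
Definition counitr H (t : tens_alg H H) : H :=
  tlift (fun x y => (counit y : K) *: (x : H)) t.

Definition is_bialgebra H : Prop :=
  [/\ is_algebra H,
      [/\ clinear (@coprod _ _ H), coprod (aone : H) = aone &
          forall x y : H, coprod (x ** y) = coprod x ** coprod y],
      [/\ clinear (@counit _ _ H), (counit (aone : H) : K) = GRing.one K &
          forall x y : H, (counit (x ** y) : K) = (counit x : K) * counit y],
      (forall x : H, coprodl (coprod x) = coprodr (coprod x)) &
      (forall x : H, counitl (coprod x) = x /\ counitr (coprod x) = x)].

Definition is_antipode H (g : H -> H) : Prop :=
  clinear g /\ forall x : H,
    tlift (fun y z => g y ** z) (coprod x) = (counit x : K) *: (aone : H) /\
    tlift (fun y z => y ** g z) (coprod x) = (counit x : K) *: (aone : H).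

Definition is_hopf H : Prop := is_bialgebra H /\ exists g, @is_antipode H g.

Definition quasitriangular H (R : tens_alg H H) : Prop :=
  [/\ invertible R,
      coprodl R = leg13 R ** leg23 R,
      coprodr R = leg13 R ** leg12 R &
      forall x : H, R ** coprod x = (tflip (coprod x) : tens_alg H H) ** R].

Definition coopposite H : hopf KT := {|
  hopf_alg := H;
  coprod := fun x => tflip (coprod x);
  counit := counit
|}.

Definition tens_hopf H B : hopf KT := {|
  hopf_alg := tens_alg H B;
  coprod := fun t => tmidflip (tmap coprod coprod t);
  counit := fun t => tlift (fun x y => (counit x : K) * (counit y : K)
                              : ctbase KT) t
|}.

Definition twisting_cocycle B (F : tens_alg B B) : Prop :=
  [/\ invertible F,
      coprodl F ** leg12 F = coprodr F ** leg23 F &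
      counitl F = aone /\ counitr F = aone].

Definition twist B (F : tens_alg B B) : hopf KT := {|
  hopf_alg := B;
  coprod := fun x => ainv F ** coprod x ** F;
  counit := counit
|}.

Definition twisted_square H (R : tens_alg H H) : hopf KT :=
  @twist (tens_hopf H H) (tlift (fun x y => (aone \ox x) \ox (y \ox aone)) R).

Definition is_module_algebra B (A : alg KT) (act : B -> A -> A) : Prop :=
  [/\ is_algebra A, cbilinear act,
      (forall a, act aone a = a) /\
      (forall x y a, act (x ** y) a = act x (act y a)),
      (forall x a b, act x (a ** b) =
         tlift (fun y z => act y a ** act z b) (coprod x)) &
      (forall x, act x aone = (counit x : K) *: (aone : A))].

Definition twist_alg B (F : tens_alg B B) (A : alg KT) (act : B -> A -> A) :
    alg KT := {|
  alg_mod := A;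
  amul := fun a b => tlift (fun x y => act x a ** act y b) F;
  aone := aone
|}.

End HopfTheory.

(* Main.v *)
Require Import Defs.
From mathcomp Require Import all_boot all_order all_algebra.
From mathcomp Require Import boolp classical_sets.

(******************************************************************************)
(*  Write B = H^op (x) H and R_ij for the R-matrix placed in legs i, j of     *)
(*  B (x) B, a fourfold tensor power of H. The coproducts of B and of H (x) H *)
(*  differ by the flip of the first factor, hence by conjugation with R_13:   *)
(*  Delta_B(x) R_13 = R_13 Delta_(H (x) H)(x). So F = R_13 R_23 twists B to   *)
(*  the twist of H (x) H by R_23. Both sides of the cocycle identity for F    *)
(*  are products of R-matrices in six legs, and are equal by two applications *)
(*  of the Yang-Baxter equation.                                              *)
(*  H^op is a Hopf algebra because the antipode S of H is invertible: with    *)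
(*  u = S(R_2) R_1 one has S^2(x) u = u x, so that u^-1 S(x) u is a skew      *)
(*  antipode. The twist of a Hopf algebra by F has antipode U S(x) V, where   *)
(*  U = J_1 S(J_2), V = S(F_1) F_2 and J = F^-1.                              *)
(******************************************************************************)

Set Implicit Arguments.
Unset Strict Implicit.
Unset Printing Implicit Defensive.

Import GRing.Theory.
Local Open Scope ring_scope.
Local Open Scope alg_scope.

(** * Families of continuous linear maps *)

(** The quasitriangularity axiom says that conjugation by R exchanges the coproduct of H with its
    opposite. Hence R_13 carries the coproduct of H^op (x) H to that of H (x) H, and conjugating
    further by R_23 gives the coproduct of the twisted square; this is [twist_coopposite_coprod].
    The real content is that R_13 R_23 is a cocycle ([coopposite_cocycleP]): the two coproduct
    axioms for R expand each side of the cocycle identity into six R-matrices, and [yang_baxter]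
    together with the commutation of R-matrices on disjoint legs turns one word into the other.

    The claim on modules is an instance of [twist_is_module_algebra]: for a twisted product,
    associativity is the cocycle identity and the unit laws are the counit conditions on F. That all
    the objects are Hopf algebras needs antipodes, which come from
    [quasitriangular_coopposite_antipode], [tens_is_hopf] and [twist_is_antipode].

    All of this takes place in completed tensor products, where an element need not be a sum of pure
    tensors. Sweedler calculus is justified by density: continuous linear maps that agree on pure
    tensors are equal ([ctens_eq]). Each such step requires that both sides be linear and continuous
    in the tensor concerned, also when it sits inside nested [tlift]s; for this continuity must be
    uniform in the other variables, which is the notion [eqclin]. The tactics [clin], [ext_pure] and
    [tsimp] automate the method. *)

Section EquicontinuousFamilies.
Local Open Scope classical_set_scope.
Context {K : comNzRingType} {KT : ctopring K}.
Implicit Types (M N P Q : ctmod KT) (I : Type).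

(** Equicontinuity: a single [U] serves all indices. The index collects the remaining variables of
    an expression, so that [cbilinear] becomes [eqclin] in each variable with the other one as
    index. *)
Definition eqclin I M P (f : I -> M -> P) : Prop :=
  (forall i, linear (f i)) /\
  forall W, mtop P W -> exists2 U, mtop M U & forall i x, U x -> W (f i x).

Lemma clinear_eqclin M P (f : M -> P) : eqclin (fun _ : unit => f) -> clinear f.
Proof.
move=> [lf cf]; split=> [|W oW]; first exact: (lf tt).
have [U oU UW] := cf W oW; apply: (opensubS oU) => [|x Ux]; last exact: (UW tt).
exact: submodule_preimage (lf tt) (opensub_submodule oW).
Qed.

Lemma cbilinear_eqclin M N P (f : M -> N -> P) :
  eqclin (fun y x => f x y) -> eqclin f -> cbilinear f.
Proof.
move=> [ll cl] [lr cr]; split=> // W oW.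
have [U oU UW] := cl W oW; have [V oV VW] := cr W oW.
by exists U, V; split=> // x y; apply: UW.
Qed.

Lemma eqclin_id I M : eqclin (fun (_ : I) (x : M) => x).
Proof. by split=> // W oW; exists W. Qed.

Lemma eqclin_comp I M N P (g : N -> P) (f : I -> M -> N) :
  clinear g -> eqclin f -> eqclin (fun i x => g (f i x)).
Proof.
move=> [lg cg] [lf cf]; split=> [i a x y|W oW]; first by rewrite lf lg.
have [U oU UW] := cf _ (cg _ oW); by exists U.
Qed.

Lemma eqclin_bilinl I M N N' P (b : N -> N' -> P) (f : I -> M -> N) (y : I -> N') :
  cbilinear b -> eqclin f -> eqclin (fun i x => b (f i x) (y i)).
Proof.
move=> [bl _ bc] [lf cf]; split=> [i a x x'|W oW]; first by rewrite lf bl.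
have [U [_ [oU _ UW _]]] := bc W oW; have [V oV VU] := cf _ oU.
by exists V => // i x /(VU i); apply: UW.
Qed.

Lemma eqclin_bilinr I M N N' P (b : N' -> N -> P) (f : I -> M -> N) (y : I -> N') :
  cbilinear b -> eqclin f -> eqclin (fun i x => b (y i) (f i x)).
Proof.
move=> [_ br bc] [lf cf]; split=> [i a x x'|W oW]; first by rewrite lf br.
have [_ [U [_ oU _ UW]]] := bc W oW; have [V oV VU] := cf _ oU.
by exists V => // i x /(VU i); apply: UW.
Qed.

Lemma scale_cbilinear M : cbilinear (fun (a : ctbase KT) (x : M) => (a : K) *: x).
Proof.
split=> [y a x x'|x a y y'|W oW].
- by rewrite scalerDl scalerA.
- by rewrite scalerDr !scalerA mulrC.
have [J oJ JW] := mtop_scale oW; exists J, W; split=> // a x.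
exact: submodZ (opensub_submodule oW) a x.
Qed.

Lemma clinear_comb M P (f g : M -> P) (a : K) :
  clinear f -> clinear g -> clinear (fun x => a *: f x + g x).
Proof.
move=> [lf cf] [lg cg]; apply: clinear_eqclin; split=> [_ b x y|W oW].
  by rewrite lf lg !scalerDr !scalerA mulrC addrACA.
have sW := opensub_submodule oW.
exists (f @^-1` W `&` g @^-1` W); first by apply: opensubI; [apply: cf|apply: cg].
by move=> _ x [Wf Wg]; apply: sW.2.
Qed.

(** An element of the completion differs from the image of a fine enough representative by an
    element of [O], so membership in an open submodule can be tested on representatives. *)
Lemma ctens_openP M N (O : set (ctens M N)) (t : ctens M N) :
  mtop (ctens M N) O ->
  (exists2 V, tens_open V &
     forall V', tens_open V' -> V' `<=` V -> O (comp_emb (tens_top M N) (t V'))) ->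
  O t.
Proof.
move=> [sO [V1 oV1 V1O]] [V2 oV2 V2O]; have oV := opensubI (l := tens_top M N) oV1 oV2.
set V := V1 `&` V2 in oV; have sV := opensub_submodule (l := tens_top M N) oV.
rewrite -[t](subrK (comp_emb (tens_top M N) (t V))); apply: submodD => //.
  apply: V1O; apply: (comp_nbhsS (tau := tens_top M N) oV) => //; first by move=> ? [].
  rewrite /comp_nbhs -[X in V X](subrK (t V - comp_emb (tens_top M N) (t V) V)).
  apply: (submodD sV); first exact: (compB _ _ (tau := tens_top M N) oV).
  by apply: (submodBC sV); apply: (comp_embE (tau := tens_top M N)).
by apply: V2O => // ? [].
Qed.

(** Pure tensors span the dense image of the free module, and an open submodule is closed. *)
Lemma ctens_open_pure M N (O : set (ctens M N)) :
  mtop (ctens M N) O -> (forall x y, O (x \ox y)) -> forall t, O t.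
Proof.
move=> oO Op t; have sO := opensub_submodule oO.
apply: ctens_openP => //; exists setT; first exact: tens_openT.
move=> V' _ _; have lemb := @comp_emb_linear _ _ (tens_top M N).
by have := freeg_span (submodule_preimage lemb sO) Op; apply.
Qed.

(** Let [V0] be the set of elements of the free module that all maps of the family send into [W]. It
    contains the bilinearity relations, which already vanish in the tensor product, and it contains
    U x N and M x V for [U], [V] chosen uniformly in the index. Hence it is open, and its closure is
    a neighbourhood valid for all indices. *)
Lemma tlift_eqclin I M N P (B : I -> M -> N -> P) :
  eqclin (fun (p : I * N) x => B p.1 x p.2) ->
  eqclin (fun (p : I * M) y => B p.1 p.2 y) ->
  eqclin (fun i => tlift (B i)).
Proof.
move=> [ll cl] [lr cr].
have bB i : cbilinear (B i).
  apply: cbilinear_eqclin; split.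
  - by move=> y; apply: (ll (i, y)).
  - by move=> W /cl[U oU UW]; exists U => // y x; apply: (UW (i, y)).
  - by move=> x; apply: (lr (i, x)).
  - by move=> W /cr[U oU UW]; exists U => // x y; apply: (UW (i, x)).
have cB i := (tliftP (bB i)).1; have EB i := (tliftP (bB i)).2.
split=> [i|W oW]; first by case: (cB i).
have sW := opensub_submodule oW.
have sub_i i : submodule (tlift (B i) @^-1` W).
  by apply: submodule_preimage => //; case: (cB i).
pose S := [set t | forall i, W (tlift (B i) t)].
have sS : submodule S.
  split=> [i|a x y Sx Sy i]; first exact: submod0 (sub_i i).
  by apply: (sub_i i).2; [apply: Sx|apply: Sy].
set V0 := comp_emb (tens_top M N) @^-1` S.
have lemb := @comp_emb_linear _ _ (tens_top M N).
have [pl pr _] := @pure_cbilinear _ _ M N.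
have oV0 : tens_open V0.
  split; first exact: submodule_preimage.
  have S0 (t : ctens M N) : t = 0 -> S t by move=> ->; apply: submod0.
  split.
  - move=> a x x' y; apply: S0; rewrite linear_funB // lemb.
    by apply/eqP; rewrite subr_eq0; apply/eqP; apply: pl.
  - move=> a x y y'; apply: S0; rewrite linear_funB // lemb.
    by apply/eqP; rewrite subr_eq0; apply/eqP; apply: pr.
  have [U oU UW] := cl W oW; have [V oV VW] := cr W oW; exists U, V; split=> // x y h i.
    by rewrite (EB i x y); apply: (UW (i, y)).
  by rewrite (EB i x y); apply: (VW (i, x)).
exists (comp_nbhs V0); first exact: comp_nbhs_open.
move=> i t Vt; apply: (ctens_openP (O := tlift (B i) @^-1` W)); first exact: (cB i).2.
exists V0 => // V' oV' V'V0; have sV0 := opensub_submodule (l := tens_top M N) oV0.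
suff : V0 (t V') by apply.
rewrite -[X in V0 X](subrK (t V0)); apply: (submodD sV0) => //.
exact: comp_compat.
Qed.

Lemma eqclin_tlift_arg I M N P Q (B : I -> M -> N -> P) (T : I -> Q -> ctens M N) :
  eqclin (fun (p : I * N) x => B p.1 x p.2) ->
  eqclin (fun (p : I * M) y => B p.1 p.2 y) ->
  eqclin T -> eqclin (fun i z => tlift (B i) (T i z)).
Proof.
move=> Bl Br [lT cT]; have [lB cB] := tlift_eqclin Bl Br.
split=> [i a x y|W oW]; first by rewrite lT lB.
have [U oU UW] := cB W oW; have [V oV VU] := cT U oU; exists V => // i z /(VU i).
exact: UW.
Qed.

(** Here the variable sits in the body and the tensor is fixed. Linearity in it is checked on pure
    tensors. For continuity, the preimage of [W] under [tlift (B i z)] is an open submodule that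
    contains all pure tensors when [z] is in [U], hence is everything. *)
Lemma eqclin_tlift_body I M N P Q (B : I -> Q -> M -> N -> P) (t : I -> ctens M N) :
  eqclin (fun (p : I * M * N) z => B p.1.1 z p.1.2 p.2) ->
  eqclin (fun (p : I * Q * N) x => B p.1.1 p.1.2 x p.2) ->
  eqclin (fun (p : I * Q * M) y => B p.1.1 p.1.2 p.2 y) ->
  eqclin (fun i z => tlift (B i z) (t i)).
Proof.
move=> [lz cz] Bl Br.
have bB i z : cbilinear (B i z).
  apply: cbilinear_eqclin; split.
  - by move=> y; apply: (Bl.1 (i, z, y)).
  - by move=> W /Bl.2[U oU UW]; exists U => // y x; apply: (UW (i, z, y)).
  - by move=> x; apply: (Br.1 (i, z, x)).
  - by move=> W /Br.2[U oU UW]; exists U => // x y; apply: (UW (i, z, x)).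
have cB i z := (tliftP (bB i z)).1; have EB i z := (tliftP (bB i z)).2.
split=> [i a x y|W oW].
  apply: (ctens_ext (g := tlift (B i (a *: x + y)))
    (g' := fun s => a *: tlift (B i x) s + tlift (B i y) s)) => //.
    exact: clinear_comb.
  by move=> u v; rewrite !EB; apply: (lz (i, u, v)).
have [U oU UW] := cz W oW; exists U => // i z Uz.
apply: (ctens_open_pure (O := tlift (B i z) @^-1` W)); first exact: (cB i z).2.
by move=> x y; rewrite /= EB; apply: (UW (i, x, y)).
Qed.

Lemma tlift_pure M N P (f : M -> N -> P) x y :
  cbilinear f -> tlift f (x \ox y) = f x y.
Proof. by move=> /tliftP[_ ->]. Qed.

Lemma ctens_eq M N P (g g' : ctens M N -> P) t :
  clinear g -> clinear g' -> (forall x y, g (x \ox y) = g' (x \ox y)) -> g t = g' t.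
Proof. by move=> cg cg' e; apply: ctens_ext. Qed.

Lemma eq_tlift M N P (f g : M -> N -> P) t :
  (forall x y, f x y = g x y) -> tlift f t = tlift g t.
Proof. by move=> e; congr tlift; apply/funext => x; apply/funext => y. Qed.

End EquicontinuousFamilies.

(** * Sweedler calculus and tensor products of algebras *)

(** Multiplication in [K] is scaling on [ctbase] only up to conversion; this rule and the next let
    [clin_eq] treat it as a bilinear operation. *)
Lemma eqclin_base_mull (K : comNzRingType) (KT : ctopring K) I (M : ctmod KT)
    (f : I -> M -> ctbase KT) (y : I -> ctbase KT) :
  eqclin f -> @eqclin K KT I M (ctbase KT) (fun i x => (f i x : K) * (y i : K)).
Proof. exact: (eqclin_bilinl _ (@scale_cbilinear K KT (ctbase KT))). Qed.

Lemma eqclin_base_mulr (K : comNzRingType) (KT : ctopring K) I (M : ctmod KT)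
    (f : I -> M -> ctbase KT) (y : I -> ctbase KT) :
  eqclin f -> @eqclin K KT I M (ctbase KT) (fun i x => (y i : K) * (f i x : K)).
Proof. exact: (eqclin_bilinr _ (@scale_cbilinear K KT (ctbase KT))). Qed.

Create HintDb clin.
#[export] Hint Constants Opaque : clin.

(** Follows the single occurrence of the variable down the expression: through the argument or the
    body of a [tlift], either side of a known bilinear map, or a known linear map. Variables bound
    on the way are added to the index. *)
Ltac clin_eq := cbv beta; first
  [ apply eqclin_id
  | lazymatch goal with
    | |- eqclin (fun i x => tlift (@?B i x) (@?t i x)) => first
      [ eapply eqclin_tlift_arg; [clin_eq | clin_eq | clin_eq]
      | eapply eqclin_tlift_body; [clin_eq | clin_eq | clin_eq] ]
    | |- eqclin (fun i => tlift (@?B i)) => apply tlift_eqclin; [clin_eq | clin_eq]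
    end
  | eapply eqclin_bilinl; [solve [eauto with clin nocore] | clin_eq]
  | eapply eqclin_bilinr; [solve [eauto with clin nocore] | clin_eq]
  | eapply eqclin_comp; [solve [eauto with clin nocore] | clin_eq]
  | apply eqclin_base_mull; clin_eq
  | apply eqclin_base_mulr; clin_eq ].

(* Proves (bi)linearity and continuity of an expression in Sweedler notation in
   which each variable occurs exactly once. *)
Ltac clin := cbv beta; lazymatch goal with
  | |- clinear _ => first [ solve [eauto with clin nocore]
                          | apply clinear_eqclin; clin_eq ]
  | |- cbilinear _ => first [ solve [eauto with clin nocore]
                            | apply cbilinear_eqclin; [clin_eq | clin_eq] ]
  end.

(** Writing [t] in Sweedler notation: [t], possibly a compound term such as [coprod x] or [R], is
    abstracted from both sides, which then only have to be compared at a pure tensor. *)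
Ltac ext_pure t x y :=
  lazymatch goal with
  | |- ?L = ?R =>
    let gL := eval pattern t in L in
    let gR := eval pattern t in R in
    lazymatch gL with ?f t => lazymatch gR with ?g t =>
      apply (@ctens_eq _ _ _ _ _ f g t); [clin | clin | intros x y; cbv beta]
    end end
  end.

Ltac tsimp := cbv beta; repeat
  (match goal with
   | |- context [@tlift ?K ?KT ?M ?N ?P ?f (pure ?x ?y)] =>
     let bf := fresh in
     assert (bf : @cbilinear K KT M N P f) by clin; rewrite (tlift_pure x y bf); clear bf
   end; cbv beta).

(* Extern hints, since the (co)domain of a map may be given either as [ctens A B]
   or as the module underlying [tens_alg A B]. *)
#[export] Hint Extern 0 (clinear ?f) =>
  match goal with h : @clinear _ _ _ _ f |- _ => exact h end : clin.
#[export] Hint Extern 0 (cbilinear ?f) =>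
  match goal with h : @cbilinear _ _ _ _ _ f |- _ => exact h end : clin.
#[export] Hint Extern 1 (cbilinear pure) => apply pure_cbilinear : clin.
#[export] Hint Extern 1 (cbilinear (@GRing.scale _ _)) =>
  apply scale_cbilinear : clin.

Section TensorMapTheory.
Context {K : comNzRingType} {KT : ctopring K}.
Implicit Types M N P Q : ctmod KT.

Lemma id_clinear M : clinear (@id M). Proof. by split=> // W oW. Qed.

Lemma comp_clinear M N P (f : N -> P) (g : M -> N) :
  clinear f -> clinear g -> clinear (f \o g).
Proof.
by move=> [lf cf] [lg cg]; split=> [a x y|W /cf/cg] //=; rewrite lg lf.
Qed.

Lemma tmapE M N P Q (f : M -> P) (g : N -> Q) x y :
  clinear f -> clinear g -> tmap f g (x \ox y) = f x \ox g y.
Proof. by move=> cf cg; rewrite /tmap; tsimp. Qed.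

Lemma tmap_clinear M N P Q (f : M -> P) (g : N -> Q) :
  clinear f -> clinear g -> clinear (tmap f g).
Proof. by move=> cf cg; rewrite /tmap; clin. Qed.

Lemma tflipE M N (x : M) (y : N) : tflip (x \ox y) = y \ox x.
Proof. by rewrite /tflip; tsimp. Qed.

Lemma tflip_clinear M N : clinear (@tflip K KT M N).
Proof. by rewrite /tflip; clin. Qed.

Lemma tassocE M N P (x : M) (y : N) (z : P) :
  tassoc ((x \ox y) \ox z) = x \ox (y \ox z).
Proof. by rewrite /tassoc; tsimp. Qed.

Lemma tassoc_clinear M N P : clinear (@tassoc K KT M N P).
Proof. by rewrite /tassoc; clin. Qed.

Lemma tmidflipE M N P Q (x : M) (y : N) (z : P) (w : Q) :
  tmidflip ((x \ox y) \ox (z \ox w)) = (x \ox z) \ox (y \ox w).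
Proof. by rewrite /tmidflip; tsimp. Qed.

Lemma tmidflip_clinear M N P Q : clinear (@tmidflip K KT M N P Q).
Proof. by rewrite /tmidflip; clin. Qed.

End TensorMapTheory.

#[export] Hint Extern 1 (clinear (fun x => x)) => apply id_clinear : clin.
#[export] Hint Extern 1 (clinear id) => apply id_clinear : clin.
#[export] Hint Extern 1 (clinear (tmap _ _)) => apply tmap_clinear : clin.
#[export] Hint Extern 1 (clinear tflip) => apply tflip_clinear : clin.
#[export] Hint Extern 1 (clinear tassoc) => apply tassoc_clinear : clin.
#[export] Hint Extern 1 (clinear tmidflip) => apply tmidflip_clinear : clin.

Section AlgebraTheory.
Context {K : comNzRingType} {KT : ctopring K}.
Implicit Types A B C D : alg KT.

Lemma amul_cbilinear A : is_algebra A -> cbilinear (@amul K KT A).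
Proof. by case. Qed.
Lemma amulA A : is_algebra A -> associative (@amul K KT A). Proof. by case. Qed.
Lemma amul1l A : is_algebra A -> left_id aone (@amul K KT A). Proof. by case. Qed.
Lemma amul1r A : is_algebra A -> right_id aone (@amul K KT A). Proof. by case. Qed.

Hint Extern 1 (cbilinear amul) => apply amul_cbilinear : clin.

Lemma tens_amulE A B (a c : A) (b d : B) : is_algebra A -> is_algebra B ->
  ((a \ox b : tens_alg A B) ** (c \ox d : tens_alg A B)) = (a ** c) \ox (b ** d).
Proof. by move=> algA algB; rewrite /amul/= -/(amul) -/(amul); tsimp. Qed.

Lemma tens_is_algebra A B : is_algebra A -> is_algebra B -> is_algebra (tens_alg A B).
Proof.
move=> algA algB.
have bm : cbilinear (@amul K KT (tens_alg A B)).
  rewrite /amul /= -/(@amul K KT A) -/(@amul K KT B); clin.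
split=> //.
- move=> s t r; ext_pure s a a'; ext_pure t b b'; ext_pure r c c'.
  by rewrite !tens_amulE // !amulA.
- by move=> s; ext_pure s a a'; rewrite tens_amulE // !amul1l.
- by move=> s; ext_pure s a a'; rewrite tens_amulE // !amul1r.
Qed.

End AlgebraTheory.

#[export] Hint Extern 1 (cbilinear amul) => apply amul_cbilinear : clin.
#[export] Hint Resolve tens_is_algebra : clin.

(** * Algebra morphisms and commuting pairs *)

Section AlgebraMorphisms.
Context {K : comNzRingType} {KT : ctopring K}.
Implicit Types A B C D : alg KT.

Definition alghom A B (f : A -> B) : Prop :=
  [/\ clinear f, f aone = aone & forall x y, f (x ** y) = f x ** f y].

Definition commuting A B C (f : A -> C) (g : B -> C) : Prop :=
  forall x y, f x ** g y = g y ** f x.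

Lemma alghom_clinear A B (f : A -> B) : alghom f -> clinear f.
Proof. by case. Qed.
Lemma alghom1 A B (f : A -> B) : alghom f -> f aone = aone.
Proof. by case. Qed.
Lemma alghomM A B (f : A -> B) x y : alghom f -> f (x ** y) = f x ** f y.
Proof. by case. Qed.

Hint Extern 2 (clinear ?f) =>
  match goal with h : alghom f |- _ => exact (alghom_clinear h) end : clin.

Lemma alghom_id A : alghom (@id A).
Proof. by split=> //; apply: id_clinear. Qed.

Lemma alghom_comp A B C (f : B -> C) (g : A -> B) :
  alghom f -> alghom g -> alghom (f \o g).
Proof.
move=> [cf f1 fM] [cg g1 gM]; split; first exact: comp_clinear.
  by rewrite /= g1 f1.
by move=> x y; rewrite /= gM fM.
Qed.

Lemma clinearZ (M N : ctmod KT) (f : M -> N) a x : clinear f -> f (a *: x) = a *: f x.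
Proof. by move=> [lf _]; have := lf a x 0; rewrite (linear_fun0 lf) !addr0. Qed.

Lemma pureZl (M N : ctmod KT) a (x : M) (y : N) : (a *: x) \ox y = a *: (x \ox y).
Proof. by apply: (clinearZ (f := pure^~ y)); clin. Qed.

Lemma pureZr (M N : ctmod KT) a (x : M) (y : N) : x \ox (a *: y) = a *: (x \ox y).
Proof. by apply: (clinearZ (f := pure x)); clin. Qed.

Lemma amulZl A (a : K) (x y : A) : is_algebra A -> (a *: x) ** y = a *: (x ** y).
Proof.
move=> [[bl _ _] _ _ _]; have := bl y a x 0; rewrite addr0 => ->.
by rewrite (linear_fun0 (bl y)) addr0.
Qed.

Lemma amulZr A (a : K) (x y : A) : is_algebra A -> x ** (a *: y) = a *: (x ** y).
Proof.
move=> [[_ br _] _ _ _]; have := br x a y 0; rewrite addr0 => ->.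
by rewrite (linear_fun0 (br x)) addr0.
Qed.

Lemma tens_aoneE A B : (aone : tens_alg A B) = aone \ox aone.
Proof. by []. Qed.

(** Leg notation in which a leg is a morphism into an arbitrary algebra instead of a numbered
    position, so that one lemma covers every placement of an R-matrix. *)
Definition tjoin A B C (f : A -> C) (g : B -> C) : tens_alg A B -> C :=
  tlift (fun x y => f x ** g y).

Lemma tjoin_clinear A B C (f : A -> C) (g : B -> C) : is_algebra C ->
  clinear f -> clinear g -> clinear (tjoin f g).
Proof. by move=> algC cf cg; rewrite /tjoin; clin. Qed.

Lemma tjoinE A B C (f : A -> C) (g : B -> C) x y : is_algebra C ->
  clinear f -> clinear g -> tjoin f g (x \ox y) = f x ** g y.
Proof. by move=> algC cf cg; rewrite /tjoin; tsimp. Qed.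

Lemma tjoin_alghom A B C (f : A -> C) (g : B -> C) :
  is_algebra A -> is_algebra B -> is_algebra C ->
  alghom f -> alghom g -> commuting f g -> alghom (tjoin f g).
Proof.
move=> algA algB algC hf hg fg.
have cf := alghom_clinear hf; have cg := alghom_clinear hg.
have cj := tjoin_clinear algC cf cg.
split=> //; first by rewrite tens_aoneE tjoinE // (alghom1 hf) (alghom1 hg) amul1l.
move=> s t; ext_pure s a a'; ext_pure t b b'.
rewrite tens_amulE // !tjoinE // (alghomM _ _ hf) (alghomM _ _ hg).
by rewrite !amulA // -(amulA algC (f a)) fg (amulA algC (f a)).
Qed.

Lemma tmap_alghom A B C D (f : A -> C) (g : B -> D) :
  is_algebra A -> is_algebra B -> is_algebra C -> is_algebra D ->
  alghom f -> alghom g -> @alghom (tens_alg A B) (tens_alg C D) (tmap f g).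
Proof.
move=> algA algB algC algD hf hg.
have cf := alghom_clinear hf; have cg := alghom_clinear hg.
split; first exact: tmap_clinear.
  by rewrite tens_aoneE tmapE // !alghom1.
move=> s t; ext_pure s a a'; ext_pure t b b'.
by rewrite tens_amulE // !tmapE // (alghomM _ _ hf) (alghomM _ _ hg) tens_amulE.
Qed.

Lemma tflip_alghom A B : is_algebra A -> is_algebra B ->
  @alghom (tens_alg A B) (tens_alg B A) tflip.
Proof.
move=> algA algB; split; first exact: tflip_clinear.
  by rewrite tens_aoneE tflipE.
move=> s t; ext_pure s a a'; ext_pure t b b'.
by rewrite tens_amulE // !tflipE tens_amulE.
Qed.

Lemma tassoc_alghom A B C : is_algebra A -> is_algebra B -> is_algebra C ->
  @alghom (tens_alg (tens_alg A B) C) (tens_alg A (tens_alg B C)) tassoc.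
Proof.
move=> algA algB algC; have algAB := tens_is_algebra algA algB.
have algBC := tens_is_algebra algB algC.
split; first exact: tassoc_clinear.
  by rewrite !tens_aoneE tassocE.
move=> s t; ext_pure s s1 z; ext_pure t t1 w; ext_pure s1 a a'; ext_pure t1 b b'.
by rewrite !tens_amulE // !tassocE !tens_amulE.
Qed.

Lemma tmidflip_alghom A B C D :
  is_algebra A -> is_algebra B -> is_algebra C -> is_algebra D ->
  @alghom (tens_alg (tens_alg A B) (tens_alg C D))
          (tens_alg (tens_alg A C) (tens_alg B D)) tmidflip.
Proof.
move=> algA algB algC algD.
have algAB := tens_is_algebra algA algB; have algCD := tens_is_algebra algC algD.
have algAC := tens_is_algebra algA algC; have algBD := tens_is_algebra algB algD.
split; first exact: tmidflip_clinear.
  by rewrite !tens_aoneE tmidflipE.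
move=> s t; ext_pure s s1 s2; ext_pure t t1 t2.
ext_pure s1 a a'; ext_pure s2 b b'; ext_pure t1 c c'; ext_pure t2 d d'.
by rewrite !tens_amulE // !tmidflipE !tens_amulE.
Qed.

Lemma inl_alghom A B : is_algebra A -> is_algebra B ->
  @alghom A (tens_alg A B) (fun x => x \ox aone).
Proof.
move=> algA algB; split=> //; first by clin.
by move=> x y; rewrite tens_amulE // amul1l.
Qed.

Lemma inr_alghom A B : is_algebra A -> is_algebra B ->
  @alghom B (tens_alg A B) (fun x => aone \ox x).
Proof.
move=> algA algB; split=> //; first by clin.
by move=> x y; rewrite tens_amulE // amul1l.
Qed.

End AlgebraMorphisms.

#[export] Hint Extern 2 (clinear ?f) =>
  match goal with h : alghom f |- _ => exact (alghom_clinear h) end : clin.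

Section Invertibility.
Context {K : comNzRingType} {KT : ctopring K}.
Implicit Types A B C : alg KT.

Lemma ainvP A (x : A) : invertible x -> is_inverse x (ainv x).
Proof. by move=> [y xy]; rewrite /ainv; case: xgetP => [z -> //|/(_ y)[]]. Qed.

Lemma left_inverse_uniq A (x y z : A) : is_algebra A ->
  y ** x = aone -> x ** z = aone -> y = z.
Proof.
by move=> algA yx xz; rewrite -[y](amul1r algA) -xz (amulA algA) yx (amul1l algA).
Qed.

Lemma ainv_eq A (x y : A) : is_algebra A -> is_inverse x y -> ainv x = y.
Proof.
move=> algA xy; have ix : invertible x by exists y.
apply: (left_inverse_uniq algA (x := x)); last by case: xy.
by case: (ainvP ix).
Qed.

Lemma amul_inverse A (x y x' y' : A) : is_algebra A ->
  is_inverse x x' -> is_inverse y y' -> is_inverse (x ** y) (y' ** x').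
Proof.
move=> algA [xx' x'x] [yy' y'y]; split.
  by rewrite (amulA algA) -(amulA algA x) yy' (amul1r algA).
by rewrite (amulA algA) -(amulA algA y') x'x (amul1r algA).
Qed.

Lemma alghom_inverse A B (f : A -> B) x y : alghom f ->
  is_inverse x y -> is_inverse (f x) (f y).
Proof. by move=> hf [xy yx]; split; rewrite -alghomM // ?xy ?yx alghom1. Qed.

Lemma amul_cancell A (x y y' z : A) : is_algebra A ->
  is_inverse x z -> x ** y = x ** y' -> y = y'.
Proof.
move=> algA [_ zx] e.
by rewrite -[y](amul1l algA) -[y'](amul1l algA) -zx -!(amulA algA) e.
Qed.

Lemma amul_cancelr A (x y y' z : A) : is_algebra A ->
  is_inverse x z -> y ** x = y' ** x -> y = y'.
Proof.
move=> algA [xz _] e.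
by rewrite -[y](amul1r algA) -[y'](amul1r algA) -xz !(amulA algA) e.
Qed.

End Invertibility.

(** * Bialgebras *)

Section Bialgebras.
Context {K : comNzRingType} {KT : ctopring K}.
Implicit Types H B C : hopf KT.

Lemma bialgebra_algebra H : is_bialgebra H -> is_algebra H.
Proof. by case. Qed.

Lemma coprod_alghom H : is_bialgebra H -> @alghom _ _ H (tens_alg H H) (@coprod _ _ H).
Proof. by case. Qed.

Lemma coprod_clinear H : is_bialgebra H -> clinear (@coprod _ _ H).
Proof. by move=> [_ []]. Qed.

Lemma counit_clinear H : is_bialgebra H -> clinear (@counit _ _ H).
Proof. by move=> [_ _ []]. Qed.

Lemma counit1 H : is_bialgebra H -> (counit (aone : H) : K) = 1.
Proof. by move=> [_ _ []]. Qed.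

Lemma counitM H (x y : H) : is_bialgebra H ->
  (counit (x ** y) : K) = (counit x : K) * counit y.
Proof. by move=> [_ _ []]. Qed.

Hint Resolve bialgebra_algebra : clin.
Hint Extern 1 (clinear coprod) => apply coprod_clinear : clin.
Hint Extern 1 (clinear counit) => apply counit_clinear : clin.

Lemma coprodlE H (x y : H) : is_bialgebra H ->
  coprodl (x \ox y : tens_alg H H) = tassoc (coprod x \ox y).
Proof.
move=> biH; have cc := coprod_clinear biH.
by rewrite /coprodl tmapE //; apply: id_clinear.
Qed.

Lemma coprodrE H (x y : H) : is_bialgebra H ->
  coprodr (x \ox y : tens_alg H H) = x \ox coprod y.
Proof.
move=> biH; have cc := coprod_clinear biH.
by rewrite /coprodr tmapE //; apply: id_clinear.
Qed.

Lemma coprodl_alghom H : is_bialgebra H ->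
  @alghom _ _ (tens_alg H H) (tens_alg H (tens_alg H H)) (@coprodl _ _ H).
Proof.
move=> biH; have algH := bialgebra_algebra biH.
have algHH := tens_is_algebra algH algH.
exact: (alghom_comp (tassoc_alghom algH algH algH)
  (tmap_alghom algH algH algHH algH (coprod_alghom biH) (@alghom_id _ _ H))).
Qed.

Lemma coprodr_alghom H : is_bialgebra H ->
  @alghom _ _ (tens_alg H H) (tens_alg H (tens_alg H H)) (@coprodr _ _ H).
Proof.
move=> biH; have algH := bialgebra_algebra biH.
have algHH := tens_is_algebra algH algH.
exact: (tmap_alghom algH algH algH algHH (@alghom_id _ _ H) (coprod_alghom biH)).
Qed.

Lemma coprodl_clinear H : is_bialgebra H -> clinear (@coprodl _ _ H).
Proof. by move=> /coprodl_alghom[]. Qed.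

Lemma coprodr_clinear H : is_bialgebra H -> clinear (@coprodr _ _ H).
Proof. by move=> /coprodr_alghom[]. Qed.

Lemma leg12E (A : alg KT) (x y : A) : leg12 (x \ox y : tens_alg A A) = x \ox (y \ox aone).
Proof. by rewrite /leg12; tsimp. Qed.

Lemma leg13E (A : alg KT) (x y : A) : leg13 (x \ox y : tens_alg A A) = x \ox (aone \ox y).
Proof. by rewrite /leg13; tsimp. Qed.

Lemma leg12_clinear (A : alg KT) : is_algebra A -> clinear (@leg12 _ _ A).
Proof. by move=> algA; rewrite /leg12; clin. Qed.

Lemma leg13_clinear (A : alg KT) : is_algebra A -> clinear (@leg13 _ _ A).
Proof. by move=> algA; rewrite /leg13; clin. Qed.

Lemma leg23_clinear (A : alg KT) : clinear (@leg23 _ _ A).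
Proof. by rewrite /leg23; clin. Qed.

Lemma leg12_alghom (A : alg KT) : is_algebra A ->
  @alghom _ _ (tens_alg A A) (tens_alg A (tens_alg A A)) (@leg12 _ _ A).
Proof.
move=> algA; have algAA := tens_is_algebra algA algA.
have cl := leg12_clinear algA; split=> //; first by rewrite tens_aoneE leg12E.
move=> s t; ext_pure s a a'; ext_pure t b b'.
by rewrite tens_amulE // !leg12E !tens_amulE // amul1l.
Qed.

Lemma leg13_alghom (A : alg KT) : is_algebra A ->
  @alghom _ _ (tens_alg A A) (tens_alg A (tens_alg A A)) (@leg13 _ _ A).
Proof.
move=> algA; have algAA := tens_is_algebra algA algA.
have cl := leg13_clinear algA; split=> //; first by rewrite tens_aoneE leg13E.
move=> s t; ext_pure s a a'; ext_pure t b b'.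
by rewrite tens_amulE // !leg13E !tens_amulE // amul1l.
Qed.

Lemma leg23_alghom (A : alg KT) : is_algebra A ->
  @alghom _ _ (tens_alg A A) (tens_alg A (tens_alg A A)) (@leg23 _ _ A).
Proof. by move=> algA; apply: inr_alghom => //; apply: tens_is_algebra. Qed.

Lemma counitl_clinear H : is_bialgebra H -> clinear (@counitl _ _ H).
Proof. by move=> biH; rewrite /counitl; clin. Qed.

Lemma counitr_clinear H : is_bialgebra H -> clinear (@counitr _ _ H).
Proof. by move=> biH; rewrite /counitr; clin. Qed.

Lemma counitlE H (x y : H) : is_bialgebra H ->
  counitl (x \ox y : tens_alg H H) = (counit x : K) *: y.
Proof. by move=> biH; rewrite /counitl; tsimp. Qed.

Lemma counitrE H (x y : H) : is_bialgebra H ->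
  counitr (x \ox y : tens_alg H H) = (counit y : K) *: x.
Proof. by move=> biH; rewrite /counitr; tsimp. Qed.

Lemma counitl_alghom H : is_bialgebra H ->
  @alghom _ _ (tens_alg H H) H (@counitl _ _ H).
Proof.
move=> biH; have algH := bialgebra_algebra biH.
have cl := counitl_clinear biH; split=> //.
  by rewrite tens_aoneE counitlE // counit1 // scale1r.
move=> s t; ext_pure s a a'; ext_pure t b b'.
by rewrite tens_amulE // !counitlE // counitM // amulZl // amulZr // scalerA.
Qed.

Lemma counitr_alghom H : is_bialgebra H ->
  @alghom _ _ (tens_alg H H) H (@counitr _ _ H).
Proof.
move=> biH; have algH := bialgebra_algebra biH.
have cl := counitr_clinear biH; split=> //.
  by rewrite tens_aoneE counitrE // counit1 // scale1r.
move=> s t; ext_pure s a a'; ext_pure t b b'.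
by rewrite tens_amulE // !counitrE // counitM // amulZl // amulZr // scalerA.
Qed.

End Bialgebras.

#[export] Hint Resolve bialgebra_algebra : clin.
#[export] Hint Extern 1 (clinear coprod) => apply coprod_clinear : clin.
#[export] Hint Extern 1 (clinear counit) => apply counit_clinear : clin.
#[export] Hint Extern 1 (clinear (@coprodl _ _ _)) => apply coprodl_clinear : clin.
#[export] Hint Extern 1 (clinear (@coprodr _ _ _)) => apply coprodr_clinear : clin.
#[export] Hint Extern 1 (clinear (@leg12 _ _ _)) => apply leg12_clinear : clin.
#[export] Hint Extern 1 (clinear (@leg13 _ _ _)) => apply leg13_clinear : clin.
#[export] Hint Extern 1 (clinear (@leg23 _ _ _)) => apply leg23_clinear : clin.
#[export] Hint Extern 1 (clinear (@counitl _ _ _)) => apply counitl_clinear : clin.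
#[export] Hint Extern 1 (clinear (@counitr _ _ _)) => apply counitr_clinear : clin.

(** * Tensor products of bialgebras *)

Section TensorBialgebra.
Context {K : comNzRingType} {KT : ctopring K} (H B : hopf KT).
Hypotheses (biH : is_bialgebra H) (biB : is_bialgebra B).

Let algH : is_algebra H := bialgebra_algebra biH.
Let algB : is_algebra B := bialgebra_algebra biB.
Let algHB : is_algebra (tens_alg H B) := tens_is_algebra algH algB.

Lemma tens_coprodE (x : H) (y : B) :
  coprod (x \ox y : tens_hopf H B) = tmidflip (coprod x \ox coprod y).
Proof.
have cH := coprod_clinear biH; have cB := coprod_clinear biB.
by rewrite {1}/coprod /= tmapE.
Qed.

Lemma tens_counitE (x : H) (y : B) :
  counit (x \ox y : tens_hopf H B) = (counit x : K) * counit y.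
Proof. by rewrite {1}/counit /=; tsimp. Qed.

Lemma tens_coprod_alghom :
  @alghom _ _ (tens_alg H B) (tens_alg (tens_alg H B) (tens_alg H B))
    (@coprod _ _ (tens_hopf H B)).
Proof.
have algHH := tens_is_algebra algH algH; have algBB := tens_is_algebra algB algB.
exact: (alghom_comp (tmidflip_alghom algH algH algB algB)
  (tmap_alghom algH algB algHH algBB (coprod_alghom biH) (coprod_alghom biB))).
Qed.

Let ccl : clinear (@coprod _ _ (tens_hopf H B)) := alghom_clinear tens_coprod_alghom.

(** The outer maps on the right are the shuffle of the triple tensor powers of H and B into that of
    H (x) B. With the analogue for [coprodr], coassociativity reduces to that of the two factors. *)
Lemma tens_coprodl (s : tens_alg H H) (t : tens_alg B B) :
  @coprodl _ _ (tens_hopf H B) (tmidflip (s \ox t)) =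
  tmap id tmidflip (tmidflip (coprodl s \ox coprodl t)).
Proof.
have cm : clinear (tmap (@coprod _ _ (tens_hopf H B)) (@id (tens_hopf H B))).
  by apply: tmap_clinear => //; apply: id_clinear.
have cl : clinear (@coprodl _ _ (tens_hopf H B)).
  by rewrite /coprodl; apply: (comp_clinear (f := tassoc)) => //; apply: tassoc_clinear.
ext_pure s x x'; ext_pure t y y'.
have cH := coprod_clinear biH; have cB := coprod_clinear biB.
rewrite tmidflipE /coprodl !tmapE ?tens_coprodE //; try exact: id_clinear.
ext_pure (coprod x) x1 x2; ext_pure (coprod y) y1 y2.
rewrite !(tmidflipE, tassocE) tmapE ?tmidflipE //; try exact: id_clinear.
exact: tmidflip_clinear.
Qed.

Lemma tens_coprodr (s : tens_alg H H) (t : tens_alg B B) :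
  @coprodr _ _ (tens_hopf H B) (tmidflip (s \ox t)) =
  tmap id tmidflip (tmidflip (coprodr s \ox coprodr t)).
Proof.
have cm : clinear (tmap (@id (tens_hopf H B)) (@coprod _ _ (tens_hopf H B))).
  by apply: tmap_clinear => //; apply: id_clinear.
rewrite /coprodr; ext_pure s x x'; ext_pure t y y'.
have cH := coprod_clinear biH; have cB := coprod_clinear biB.
rewrite tmidflipE !tmapE ?tens_coprodE ?tmidflipE ?tmapE //; try exact: id_clinear.
exact: tmidflip_clinear.
Qed.

Lemma tens_is_bialgebra : is_bialgebra (tens_hopf H B).
Proof.
have algT : is_algebra (tens_alg (tens_alg H B) (tens_alg H B)) by apply: tens_is_algebra.
have ccu : clinear (@counit _ _ (tens_hopf H B)).
  by rewrite /counit /= -!/(@counit _ _ _); clin.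
have ccul : clinear (@counitl _ _ (tens_hopf H B)) by rewrite /counitl; clin.
have ccur : clinear (@counitr _ _ (tens_hopf H B)) by rewrite /counitr; clin.
split=> //; [exact: tens_coprod_alghom| | |].
- split=> //.
    by rewrite [aone]tens_aoneE tens_counitE !counit1 // mulr1.
  move=> s t; ext_pure s x x'; ext_pure t y y'.
  by rewrite [_ ** _]tens_amulE // !tens_counitE !counitM // mulrACA.
- have cl : clinear (@coprodl _ _ (tens_hopf H B)).
    by rewrite /coprodl; apply: (comp_clinear (f := tassoc)); clin.
  have cr : clinear (@coprodr _ _ (tens_hopf H B)) by rewrite /coprodr; clin.
  move=> s; ext_pure s x y; rewrite tens_coprodE tens_coprodl tens_coprodr.
  by case: biH => _ _ _ -> _; case: biB => _ _ _ -> _.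
move=> s; split; ext_pure s x y; rewrite tens_coprodE.
- have [_ _ _ _ /(_ x)[ex _]] := biH; have [_ _ _ _ /(_ y)[ey _]] := biB.
  rewrite -[X in _ = X \ox _]ex -[X in _ = _ \ox X]ey.
  ext_pure (coprod x) x1 x2; ext_pure (coprod y) y1 y2.
  rewrite tmidflipE (counitlE _ _ biH) (counitlE _ _ biB) /counitl; tsimp.
  by rewrite tens_counitE pureZl pureZr scalerA.
- have [_ _ _ _ /(_ x)[_ ex]] := biH; have [_ _ _ _ /(_ y)[_ ey]] := biB.
  rewrite -[X in _ = X \ox _]ex -[X in _ = _ \ox X]ey.
  ext_pure (coprod x) x1 x2; ext_pure (coprod y) y1 y2.
  rewrite tmidflipE (counitrE _ _ biH) (counitrE _ _ biB) /counitr; tsimp.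
  by rewrite tens_counitE pureZl pureZr scalerA.
Qed.

End TensorBialgebra.

#[export] Hint Resolve tens_is_bialgebra : clin.

(** * Antipodes *)

Section Antipodes.
Context {K : comNzRingType} {KT : ctopring K}.

(** A left and a right inverse of [g] in the convolution algebra agree: f = f * (g * h) = (f * g) *
    h = h. The map [mu] below evaluates the threefold convolution product before coassociativity is
    applied. *)
Lemma convolution_inverse_uniq (C : hopf KT) (A : alg KT) (f g h : C -> A) :
  is_bialgebra C -> is_algebra A -> clinear f -> clinear g -> clinear h ->
  (forall x, tlift (fun y z => f y ** g z) (coprod x) = (counit x : K) *: aone) ->
  (forall x, tlift (fun y z => g y ** h z) (coprod x) = (counit x : K) *: aone) ->
  f =1 h.
Proof.
move=> biC algA cf cg ch fg gh x.
pose mu (t : tens_alg C (tens_alg C C)) :=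
  tlift (fun y s => tlift (fun z w => f y ** g z ** h w) s) t.
have cmu : clinear mu by rewrite /mu; clin.
have [_ _ _ /(_ x) xA /(_ x)[xl xr]] := biC.
have <- : mu (coprodr (coprod x)) = f x.
  rewrite -[in RHS]xr; ext_pure (coprod x) y z; rewrite coprodrE // counitrE //.
  rewrite /mu; tsimp.
  rewrite (clinearZ _ _ cf) -[f y in RHS](amul1r algA) -amulZr // -gh.
  by ext_pure (coprod z) z1 z2; tsimp; rewrite amulA.
rewrite -xA -[in RHS]xl; ext_pure (coprod x) y z; rewrite coprodlE // counitlE //.
rewrite (clinearZ _ _ ch) -[h z in RHS](amul1l algA) -amulZl // -fg.
by ext_pure (coprod y) y1 y2; rewrite tassocE /mu; tsimp.
Qed.

Section Antipode.
Context (B : hopf KT) (S : B -> B).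
Hypotheses (biB : is_bialgebra B) (antS : is_antipode S).

Let algB : is_algebra B := bialgebra_algebra biB.

Lemma antipode_clinear : clinear S. Proof. by case: antS. Qed.
Let cS := antipode_clinear.

(** Since S is antimultiplicative, [sandwichl] is a right action of B (x) B on B and [sandwichr] a
    left action. The antipode axioms say that coproducts act on the unit through the counit. *)
Definition sandwichl (w : B) (t : tens_alg B B) : B :=
  tlift (fun y z => S y ** w ** z) t.
Definition sandwichr (w : B) (t : tens_alg B B) : B :=
  tlift (fun y z => y ** w ** S z) t.

Lemma sandwichl_cbilinear : cbilinear sandwichl.
Proof. by rewrite /sandwichl; clin. Qed.

Lemma sandwichr_cbilinear : cbilinear sandwichr.
Proof. by rewrite /sandwichr; clin. Qed.

Hint Extern 1 (cbilinear sandwichl) => apply sandwichl_cbilinear : clin.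
Hint Extern 1 (cbilinear sandwichr) => apply sandwichr_cbilinear : clin.

Lemma sandwichlE w x y : sandwichl w (x \ox y) = S x ** w ** y.
Proof. by rewrite /sandwichl; tsimp. Qed.

Lemma sandwichrE w x y : sandwichr w (x \ox y) = x ** w ** S y.
Proof. by rewrite /sandwichr; tsimp. Qed.

Lemma sandwichlZ a w t : sandwichl (a *: w) t = a *: sandwichl w t.
Proof. by apply: (clinearZ (f := sandwichl^~ t)); clin. Qed.

Lemma sandwichrZ a w t : sandwichr (a *: w) t = a *: sandwichr w t.
Proof. by apply: (clinearZ (f := sandwichr^~ t)); clin. Qed.

Lemma sandwichl_coprod x : sandwichl aone (coprod x) = (counit x : K) *: (aone : B).
Proof.
by rewrite -(antS.2 x).1; apply: eq_tlift => y z; rewrite amul1r.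
Qed.

Lemma sandwichr_coprod x : sandwichr aone (coprod x) = (counit x : K) *: (aone : B).
Proof.
by rewrite -(antS.2 x).2; apply: eq_tlift => y z; rewrite amul1r.
Qed.

Lemma antipode1 : S aone = aone.
Proof.
have := sandwichl_coprod aone.
by rewrite (alghom1 (coprod_alghom biB)) sandwichlE !amul1r // counit1 // scale1r.
Qed.

(** In the convolution algebra of maps from B (x) B to B, the multiplication has S(u v) as left
    inverse and S(v) S(u) as right inverse. *)
Lemma antipodeM x y : S (x ** y) = S y ** S x.
Proof.
pose mul (t : tens_hopf B B) : B := tlift amul t.
pose rmul (t : tens_hopf B B) : B := tlift (fun u v => S v ** S u) t.
have cm : clinear mul by rewrite /mul; clin.
have cr : clinear rmul by rewrite /rmul; clin.
have mulE u v : mul (u \ox v) = u ** v by rewrite /mul; tsimp.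
have rmulE u v : rmul (u \ox v) = S v ** S u by rewrite /rmul; tsimp.
have biT := tens_is_bialgebra biB biB.
rewrite -mulE -rmulE.
apply: (convolution_inverse_uniq (g := mul) (f := fun t => S (mul t)) biT algB) => //.
- by clin.
- move=> t; ext_pure t u v; rewrite tens_coprodE // tens_counitE //.
  rewrite -counitM // -sandwichl_coprod (alghomM _ _ (coprod_alghom biB)).
  have algBB := tens_is_algebra algB algB.
  ext_pure (coprod u) u1 u2; ext_pure (coprod v) v1 v2.
  rewrite tmidflipE tens_amulE // sandwichlE; tsimp.
  by rewrite !mulE amul1r.
move=> t; ext_pure t u v; rewrite tens_coprodE // tens_counitE //.
(* The product u_1 v_1 S(v_2) S(u_2) is a nested sandwich; it collapses from the inside, first at
   [v] and then at [u]. *)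
have -> : (counit u : K) * (counit v : K) *: (aone : B) =
    sandwichr (sandwichr aone (coprod v)) (coprod u).
  by rewrite sandwichr_coprod sandwichrZ sandwichr_coprod scalerA mulrC.
ext_pure (coprod u) u1 u2; ext_pure (coprod v) v1 v2.
rewrite tmidflipE !sandwichrE; tsimp.
by rewrite !mulE !rmulE amul1r // !amulA.
Qed.

Lemma sandwichl_mul w (s t : tens_alg B B) :
  sandwichl w (s ** t) = sandwichl (sandwichl w s) t.
Proof.
have algBB := tens_is_algebra algB algB.
ext_pure s u v; ext_pure t u' v'.
by rewrite tens_amulE // !sandwichlE antipodeM !amulA.
Qed.

Lemma sandwichr_mul w (s t : tens_alg B B) :
  sandwichr w (s ** t) = sandwichr (sandwichr w t) s.
Proof.
have algBB := tens_is_algebra algB algB.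
ext_pure s u v; ext_pure t u' v'.
by rewrite tens_amulE // !sandwichrE antipodeM !amulA.
Qed.

Lemma sandwichl1 w : sandwichl w aone = w.
Proof. by rewrite tens_aoneE sandwichlE antipode1 amul1l // amul1r. Qed.

Lemma sandwichr1 w : sandwichr w aone = w.
Proof. by rewrite tens_aoneE sandwichrE antipode1 amul1l // amul1r. Qed.

End Antipode.

End Antipodes.

(** * Twists *)

#[export] Hint Extern 1 (cbilinear (@sandwichl _ _ _ _)) =>
  apply sandwichl_cbilinear : clin.
#[export] Hint Extern 1 (cbilinear (@sandwichr _ _ _ _)) =>
  apply sandwichr_cbilinear : clin.

Section Twist.
Context {K : comNzRingType} {KT : ctopring K} (B : hopf KT) (F : tens_alg B B).
Hypotheses (biB : is_bialgebra B) (cocF : twisting_cocycle F).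

Let algB : is_algebra B := bialgebra_algebra biB.
Let algBB : is_algebra (tens_alg B B) := tens_is_algebra algB algB.
Let algB3 : is_algebra (tens_alg B (tens_alg B B)) := tens_is_algebra algB algBB.
Let J : tens_alg B B := ainv F.

Let FJ : is_inverse F J. Proof. by apply: ainvP; case: cocF. Qed.

Let cocycleF : coprodl F ** leg12 F = coprodr F ** leg23 F.
Proof. by case: cocF. Qed.

Let twist_coprodE (x : B) : @coprod _ _ (twist F) x = J ** coprod x ** F.
Proof. by []. Qed.

Lemma twist_coprod_alghom : @alghom _ _ B (tens_alg B B) (@coprod _ _ (twist F)).
Proof.
have cc := coprod_clinear biB; split.
- have -> : @coprod _ _ (twist F) = fun x => J ** coprod (x : B) ** F by [].
  by clin.
- by rewrite twist_coprodE (alghom1 (coprod_alghom biB)) (amul1r algBB) FJ.2.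
move=> x y; rewrite !twist_coprodE (alghomM _ _ (coprod_alghom biB)) -!(amulA algBB).
congr (_ ** (_ ** _)).
by rewrite (amulA algBB F) FJ.1 amul1l.
Qed.

Let ccl : clinear (@coprod _ _ (twist F)) := alghom_clinear twist_coprod_alghom.

Let tassoc_ainl (s : tens_alg B B) : tassoc (s \ox (aone : B)) = leg12 s.
Proof. by ext_pure s u v; rewrite tassocE leg12E. Qed.

Lemma twist_coprodl (t : tens_alg B B) :
  @coprodl _ _ (twist F) t = leg12 J ** coprodl t ** leg12 F.
Proof.
have cl : clinear (@coprodl _ _ (twist F)).
  by rewrite /coprodl; apply: (comp_clinear (f := tassoc)); clin.
ext_pure t x y; rewrite (coprodlE _ _ biB) /coprodl tmapE //; try exact: id_clinear.
rewrite twist_coprodE.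
have assocM := alghomM _ _ (tassoc_alghom algB algB algB).
rewrite -[in LHS](amul1l algB y) -[in LHS](amul1r algB (aone ** y)).
by rewrite -!tens_amulE // !assocM !tassoc_ainl.
Qed.

Lemma twist_coprodr (t : tens_alg B B) :
  @coprodr _ _ (twist F) t = leg23 J ** coprodr t ** leg23 F.
Proof.
have cl : clinear (@coprodr _ _ (twist F)) by rewrite /coprodr; clin.
ext_pure t x y; rewrite (coprodrE _ _ biB) /coprodr tmapE //; try exact: id_clinear.
rewrite twist_coprodE /leg23.
by rewrite !tens_amulE // amul1l // amul1r.
Qed.

Let legF12 := alghom_inverse (leg12_alghom algB) FJ.
Let legF23 := alghom_inverse (leg23_alghom algB) FJ.
Let coprodlF := alghom_inverse (coprodl_alghom biB) FJ.
Let coprodrF := alghom_inverse (coprodr_alghom biB) FJ.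

Let cocycleJ : leg12 J ** coprodl J = leg23 J ** coprodr J.
Proof.
apply: (left_inverse_uniq algB3 (x := coprodl F ** leg12 F)).
  by case: (amul_inverse algB3 coprodlF legF12).
by rewrite cocycleF; case: (amul_inverse algB3 coprodrF legF23).
Qed.

(** Either iterated coproduct is the iterated coproduct of B between two outer factors; those on the
    right agree by the cocycle identity, those on the left by its inverse [cocycleJ]. *)
Lemma twist_is_bialgebra : is_bialgebra (twist F).
Proof.
have [_ _ [counitF1 counitF2]] := cocF.
have counitJ1 : counitl J = aone.
  have [FJl _] := alghom_inverse (counitl_alghom biB) FJ.
  by rewrite -FJl counitF1 amul1l.
have counitJ2 : counitr J = aone.
  have [FJr _] := alghom_inverse (counitr_alghom biB) FJ.
  by rewrite -FJr counitF2 amul1l.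
split=> //; [exact: twist_coprod_alghom|by case: biB| |].
- move=> x; rewrite twist_coprodl twist_coprodr twist_coprodE.
  rewrite !(alghomM _ _ (coprodl_alghom biB)) !(alghomM _ _ (coprodr_alghom biB)).
  have [_ _ _ -> _] := biB; rewrite !(amulA algB3) cocycleJ.
  by rewrite -!(amulA algB3) cocycleF.
move=> x; rewrite twist_coprodE; have [_ _ _ _ /(_ x)[xl xr]] := biB.
have cl : @counitl _ _ (twist F) = @counitl _ _ B by [].
have cr : @counitr _ _ (twist F) = @counitr _ _ B by [].
rewrite cl cr !(alghomM _ _ (counitl_alghom biB)) !(alghomM _ _ (counitr_alghom biB)).
by rewrite xl xr counitJ1 counitJ2 counitF1 counitF2 amul1l // amul1r.
Qed.

Section TwistAntipode.
Variable (S : B -> B).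
Hypothesis antS : is_antipode S.

Let cS := antipode_clinear antS.
Let U : B := sandwichr S aone J.
Let V : B := sandwichl S aone F.

(* Apply [a (x) b (x) c |-> a S(b) c] to
   [F_23 J_12 = (id (x) Delta)(J) (Delta (x) id)(F)]. *)
Let UV1 : U ** V = aone.
Proof.
pose mu (t : tens_alg B (tens_alg B B)) : B :=
  tlift (fun x s => tlift (fun y z => x ** S y ** z) s) t.
have cmu : clinear mu by rewrite /mu; clin.
have muE x y z : mu (x \ox (y \ox z)) = x ** S y ** z by rewrite /mu; tsimp.
have -> : U ** V = mu (leg23 F ** leg12 J).
  rewrite /U /V /leg23; ext_pure J x y; ext_pure F z w.
  rewrite sandwichrE // sandwichlE // leg12E !tens_amulE // muE (antipodeM biB antS).
  by rewrite !amul1r // amul1l // !amulA.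
have -> : leg23 F ** leg12 J = coprodr J ** coprodl F.
  apply: (amul_cancell algB3 coprodrF); rewrite !(amulA algB3) coprodrF.1 -cocycleF.
  by rewrite -(amulA algB3) legF12.1 amul1l // amul1r.
(* With p = Delta(J_2) and q = Delta(F_1) the inner factors q_1 S(q_2) and S(p_1) p_2 become
   counits. *)
have muM (x y : B) (p q : tens_alg B B) :
    mu ((x \ox p : tens_alg B (tens_alg B B)) ** tassoc (q \ox y)) =
    x ** sandwichr S aone q ** sandwichl S aone p ** y.
  ext_pure p p1 p2; ext_pure q q1 q2; rewrite tassocE !tens_amulE // muE.
  by rewrite sandwichrE // sandwichlE // (antipodeM biB antS) !amul1r // !amulA.
have [_ _ [counitF1 _]] := cocF.
have counitJ2 : counitr J = aone.
  have [FJr _] := alghom_inverse (counitr_alghom biB) FJ.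
  by have [_ _ [_ e]] := cocF; rewrite -FJr e amul1l.
have -> : aone = counitr J ** counitl F by rewrite counitJ2 counitF1 amul1l.
ext_pure J x y; ext_pure F z w; rewrite coprodrE // coprodlE // muM.
rewrite sandwichr_coprod // sandwichl_coprod // counitlE // counitrE //.
by rewrite !(amulZl, amulZr) // !amul1r // scalerA mulrC.
Qed.

(** In terms of the sandwich actions: J sends V to 1 because F J = 1, then Delta(x) contributes the
    counit, then F brings back V, and U V = 1. On the other side F sends U to 1 and J brings back
    U. *)
Lemma twist_is_antipode : @is_antipode _ _ (twist F) (fun x => U ** S x ** V).
Proof.
split; first by clin.
move=> x; set T := coprod (x : twist F).
have TE : T = J ** coprod (x : B) ** F by [].
have -> : tlift (fun y z => (U ** S y ** V) ** z) T = U ** sandwichl S V T.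
  by ext_pure T y z; tsimp; rewrite sandwichlE // !amulA.
have -> : tlift (fun y z => y ** (U ** S z ** V)) T = sandwichr S U T ** V.
  by ext_pure T y z; tsimp; rewrite sandwichrE // !amulA.
have VJ : sandwichl S V J = aone.
  by rewrite /V -(sandwichl_mul biB antS) FJ.1 (sandwichl1 biB antS).
have UF : sandwichr S U F = aone.
  by rewrite /U -(sandwichr_mul biB antS) FJ.1 (sandwichr1 biB antS).
rewrite TE !(sandwichl_mul biB antS) VJ !(sandwichr_mul biB antS) UF.
rewrite sandwichl_coprod // sandwichr_coprod // sandwichlZ // sandwichrZ //.
by rewrite amulZl // amulZr // -/U -/V UV1.
Qed.

End TwistAntipode.

(** * Module algebras over a twist *)

Section TwistModuleAlgebra.
Variables (A : alg KT) (act : B -> A -> A).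
Hypothesis modA : is_module_algebra act.

Let algA : is_algebra A. Proof. by case: modA. Qed.
Let bact : cbilinear act. Proof. by case: modA. Qed.
Let act1 a : act aone a = a. Proof. by case: modA => _ _ []. Qed.
Let actM x y a : act (x ** y) a = act x (act y a).
Proof. by case: modA => _ _ []. Qed.

Let act2 (t : tens_alg B B) (a b : A) : A := tlift (fun x y => act x a ** act y b) t.
Let act3 (t : tens_alg B (tens_alg B B)) (a b c : A) : A :=
  tlift (fun x s => act x a ** act2 s b c) t.

Let act2E x y a b : act2 (x \ox y) a b = act x a ** act y b.
Proof. by rewrite /act2; tsimp. Qed.

Let act2_coprod x a b : act x (a ** b) = act2 (coprod x) a b.
Proof. by case: modA. Qed.

Let act2_clinear a b : clinear (fun t => act2 t a b).
Proof. by rewrite /act2; clin. Qed.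

Let act3_clinear a b c : clinear (fun t => act3 t a b c).
Proof. by rewrite /act3 /act2; clin. Qed.

Let act2M t x y a b :
  act2 (t ** (x \ox y : tens_alg B B)) a b = act2 t (act x a) (act y b).
Proof.
have c2 := act2_clinear.
apply: (@ctens_eq _ _ _ _ _ (fun t : tens_alg B B =>
  act2 (t ** (x \ox y : tens_alg B B)) a b)
  (fun t => act2 t (act x a) (act y b))) => [||u v].
- by apply: (comp_clinear (c2 a b)); clin.
- exact: c2.
by rewrite tens_amulE // !act2E !actM.
Qed.

Let act_act2 x q a b : act x (act2 q a b) = act2 (coprod x ** q) a b.
Proof.
have c2 := act2_clinear; rewrite /act2.
by ext_pure q u v; tsimp; rewrite act2_coprod -act2M.
Qed.

(** For p = q = F, this and [act2_act2r] turn the two bracketings of a triple twisted product into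
    the two sides of the cocycle identity. *)
Let act2_act2l (p q : tens_alg B B) a b c :
  act2 p (act2 q a b) c = act3 (coprodl p ** leg12 q) a b c.
Proof.
have c2 := act2_clinear; have c3 := act3_clinear.
have assoc3 (s : tens_alg B B) y :
    act3 (tassoc (s \ox y)) a b c = act2 s a b ** act y c.
  rewrite /act3 /act2; ext_pure s u v.
  by rewrite tassocE; tsimp; rewrite amulA.
rewrite {1}/act2 /act3 /act2; ext_pure p x y; tsimp.
rewrite -/(act2 q a b) act_act2 -assoc3 coprodlE //.
rewrite -(tassoc_ainl q) -(alghomM _ _ (tassoc_alghom algB algB algB)).
by rewrite tens_amulE // amul1r.
Qed.

Let act2_act2r (p q : tens_alg B B) a b c :
  act2 p a (act2 q b c) = act3 (coprodr p ** leg23 q) a b c.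
Proof.
rewrite {1}/act2 /act3 /act2; ext_pure p x y; tsimp.
rewrite -/(act2 q b c) act_act2 coprodrE // /leg23 tens_amulE // amul1r //.
by rewrite /act2; tsimp.
Qed.

Lemma twist_is_module_algebra :
  @is_module_algebra _ _ (twist F) (twist_alg F act) act.
Proof.
have tmulE a b : @amul _ _ (twist_alg F act) a b = act2 F a b by [].
have [_ _ [counitF1 counitF2]] := cocF.
have actunit x : act x aone = (counit x : K) *: aone by case: modA.
have actZ a x y : act (a *: x) y = a *: act x y.
  by apply: (clinearZ (f := act^~ y)); clin.
split=> //.
- split.
  + have -> : @amul _ _ (twist_alg F act) = fun a b => act2 F a b by [].
    by rewrite /act2; clin.
  + by move=> a b c; rewrite !tmulE act2_act2l act2_act2r cocycleF.
  + move=> a; rewrite tmulE -[RHS]act1 -counitF1.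
    have e (t : tens_alg B B) : act2 t aone a = act (counitl t) a.
      rewrite /act2; ext_pure t x y; tsimp.
      by rewrite actunit amulZl // amul1l // counitlE // actZ.
    exact: e.
  + move=> a; rewrite tmulE -[RHS]act1 -counitF2.
    have e (t : tens_alg B B) : act2 t a aone = act (counitr t) a.
      rewrite /act2; ext_pure t x y; tsimp.
      by rewrite actunit amulZr // amul1r // counitrE // actZ.
    exact: e.
move=> x a b; rewrite tmulE act_act2.
have e (s t : tens_alg B B) :
    tlift (fun y z => act2 s (act y a) (act z b)) t = act2 (s ** t) a b.
  rewrite /act2; ext_pure t u v; tsimp.
  exact: (esym (act2M _ _ _ _ _)).
(* The defining relation of the twisted coproduct: moving F to the left past Delta(x) replaces
   Delta(x) by its twist. *)
have -> : coprod (x : B) ** F = F ** coprod (x : twist F).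
  by rewrite twist_coprodE !(amulA algBB) FJ.1 amul1l.
by rewrite -e.
Qed.

End TwistModuleAlgebra.

End Twist.

(** * Quasitriangular Hopf algebras *)

Lemma twist_is_hopf (K : comNzRingType) (KT : ctopring K) (B : hopf KT)
  (F : tens_alg B B) : is_hopf B -> twisting_cocycle F -> is_hopf (twist F).
Proof.
move=> [biB [S antS]] cocF; split; first exact: twist_is_bialgebra.
by exists (fun x => sandwichr S aone (ainv F) ** S x ** sandwichl S aone F);
  apply: twist_is_antipode.
Qed.

Lemma tens_is_hopf (K : comNzRingType) (KT : ctopring K) (H B : hopf KT) :
  is_hopf H -> is_hopf B -> is_hopf (tens_hopf H B).
Proof.
move=> [biH [S antS]] [biB [T antT]]; have biHB := tens_is_bialgebra biH biB.
have algH := bialgebra_algebra biH; have algB := bialgebra_algebra biB.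
have algHB := tens_is_algebra algH algB.
have cS := antipode_clinear antS; have cT := antipode_clinear antT.
split=> //; exists (tmap S T); split; first exact: tmap_clinear.
have tZ a b : (a *: (aone : H)) \ox (b *: (aone : B)) = a * b *: (aone : tens_alg H B).
  by rewrite pureZl pureZr scalerA.
have cST := tmap_clinear cS cT.
move=> t; split; ext_pure t x y; rewrite tens_coprodE // tens_counitE // -tZ.
  rewrite -(sandwichl_coprod biH antS) -(sandwichl_coprod biB antT).
  ext_pure (coprod x) x1 x2; ext_pure (coprod y) y1 y2.
  rewrite tmidflipE !sandwichlE //; tsimp.
  by rewrite tmapE // tens_amulE // !amul1r.
rewrite -(sandwichr_coprod biH antS) -(sandwichr_coprod biB antT).
ext_pure (coprod x) x1 x2; ext_pure (coprod y) y1 y2.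
rewrite tmidflipE !sandwichrE //; tsimp.
by rewrite tmapE // tens_amulE // !amul1r.
Qed.

(** * The coopposite bialgebra *)

Section Coopposite.
Context {K : comNzRingType} {KT : ctopring K} (H : hopf KT).
Hypothesis biH : is_bialgebra H.

Let algH : is_algebra H := bialgebra_algebra biH.
Let algHH : is_algebra (tens_alg H H) := tens_is_algebra algH algH.

Let coprodE (x : H) : @coprod _ _ (coopposite H) x = tflip (coprod x).
Proof. by []. Qed.

Lemma coopposite_coprod_alghom :
  @alghom _ _ H (tens_alg H H) (@coprod _ _ (coopposite H)).
Proof. exact: (alghom_comp (tflip_alghom algH algH) (coprod_alghom biH)). Qed.

Let ccl : clinear (@coprod _ _ (coopposite H)) :=
  alghom_clinear coopposite_coprod_alghom.

(** Reversing the three legs exchanges [coprodl] and [coprodr] when passing to the opposite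
    coproduct, so coassociativity carries over. *)
Let trev3 (t : tens_alg H (tens_alg H H)) : tens_alg H (tens_alg H H) :=
  tlift (fun x s => tlift (fun y z => z \ox (y \ox x)) s) t.

Lemma coopposite_is_bialgebra : is_bialgebra (coopposite H).
Proof.
have crev : clinear trev3 by rewrite /trev3; clin.
have revE x y z : trev3 (x \ox (y \ox z)) = z \ox (y \ox x).
  by rewrite /trev3; tsimp.
have cl : clinear (@coprodl _ _ (coopposite H)).
  by rewrite /coprodl; apply: (comp_clinear (f := tassoc)); clin.
have cr : clinear (@coprodr _ _ (coopposite H)) by rewrite /coprodr; clin.
have revl (t : tens_alg H H) :
    @coprodl _ _ (coopposite H) (tflip t) = trev3 (coprodr t).
  ext_pure t x y; rewrite tflipE (coprodrE _ _ biH) /coprodl tmapE //.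
  rewrite coprodE; ext_pure (coprod y) y1 y2.
  by rewrite tflipE tassocE revE.
have revr (t : tens_alg H H) :
    @coprodr _ _ (coopposite H) (tflip t) = trev3 (coprodl t).
  ext_pure t x y; rewrite tflipE (coprodlE _ _ biH) /coprodr tmapE //.
  rewrite coprodE; ext_pure (coprod x) x1 x2.
  by rewrite tflipE tassocE revE.
have cul := counitl_clinear biH; have cur := counitr_clinear biH.
have flipl (t : tens_alg H H) : @counitl _ _ (coopposite H) (tflip t) = @counitr _ _ H t.
  have c' : clinear (@counitl _ _ (coopposite H)) := cul.
  by ext_pure t x y; rewrite tflipE (counitrE _ _ biH); apply: (counitlE _ _ biH).
have flipr (t : tens_alg H H) : @counitr _ _ (coopposite H) (tflip t) = @counitl _ _ H t.
  have c' : clinear (@counitr _ _ (coopposite H)) := cur.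
  by ext_pure t x y; rewrite tflipE (counitlE _ _ biH); apply: (counitrE _ _ biH).
split=> //; [exact: coopposite_coprod_alghom|by case: biH| |] => x.
  by rewrite coprodE revl revr; have [_ _ _ -> _] := biH.
by rewrite coprodE flipl flipr; have [_ _ _ _ /(_ x)[]] := biH.
Qed.

End Coopposite.

(** * R-matrices, their compatibility with counit and antipode, and the skew antipode *)

Section Quasitriangular.
Context {K : comNzRingType} {KT : ctopring K} (H : hopf KT) (R : tens_alg H H).
Hypotheses (biH : is_bialgebra H) (qtR : quasitriangular R).

Let algH : is_algebra H := bialgebra_algebra biH.
Let algHH : is_algebra (tens_alg H H) := tens_is_algebra algH algH.
Let algH3 : is_algebra (tens_alg H (tens_alg H H)) := tens_is_algebra algH algHH.
Let J : tens_alg H H := ainv R.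

Let RJ : is_inverse R J. Proof. by apply: ainvP; case: qtR. Qed.
Let Rl : coprodl R = leg13 R ** leg23 R. Proof. by case: qtR. Qed.
Let Rr : coprodr R = leg13 R ** leg12 R. Proof. by case: qtR. Qed.
Let Rcoprod (x : H) : R ** coprod x = (tflip (coprod x) : tens_alg H H) ** R.
Proof. by case: qtR. Qed.

(** Applying the counit to the first leg of (Delta (x) id)(R) = R_13 R_23 gives R = (1 (x) (eps (x)
    id)(R)) R, and R is invertible. *)
Lemma counitl_Rmatrix : counitl R = aone.
Proof.
pose mu (t : tens_alg H (tens_alg H H)) : tens_alg H H :=
  tlift (fun x s => (counit x : K) *: (s : ctens H H)) t.
have cmu : clinear mu by rewrite /mu; clin.
have muE x s : mu (x \ox s) = (counit x : K) *: s by rewrite /mu; tsimp.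
have mul (t : tens_alg H H) : mu (coprodl t) = t.
  ext_pure t x y; rewrite coprodlE //.
  have [_ _ _ _ /(_ x)[xl _]] := biH; rewrite -[in RHS]xl.
  by ext_pure (coprod x) x1 x2; rewrite tassocE muE counitlE // pureZl.
have muM (s t : tens_alg H H) :
    mu (leg13 s ** leg23 t) = (aone \ox counitl s : tens_alg H H) ** t.
  ext_pure s x y; ext_pure t z w; rewrite leg13E /leg23 !tens_amulE // muE.
  by rewrite counitlE // amulZl // pureZr amul1r.
have e : (aone \ox counitl R : tens_alg H H) ** R = aone ** R.
  by rewrite -muM -Rl mul amul1l.
have := amul_cancelr algHH RJ e; move/(congr1 (@counitl _ _ H)).
by rewrite tens_aoneE !counitlE // counit1 // !scale1r.
Qed.

Lemma counitr_Rmatrix : counitr R = aone.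
Proof.
pose mu (t : tens_alg H (tens_alg H H)) : tens_alg H H :=
  tlift (fun x s => x \ox counitr (s : tens_alg H H)) t.
have cmu : clinear mu by rewrite /mu; clin.
have muE x (s : tens_alg H H) : mu (x \ox s) = x \ox counitr s by rewrite /mu; tsimp.
have mur (t : tens_alg H H) : mu (coprodr t) = t.
  ext_pure t x y; rewrite coprodrE // muE.
  by have [_ _ _ _ /(_ y)[_ ->]] := biH.
have muM (s t : tens_alg H H) :
    mu (leg13 s ** leg12 t) = (counitr s \ox aone : tens_alg H H) ** t.
  ext_pure s x y; ext_pure t z w; rewrite leg13E leg12E !tens_amulE // muE.
  by rewrite !counitrE // amulZl // pureZl pureZr amul1r.
have e : (counitr R \ox aone : tens_alg H H) ** R = aone ** R.
  by rewrite -muM -Rr mur amul1l.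
have := amul_cancelr algHH RJ e; move/(congr1 (@counitr _ _ H)).
by rewrite tens_aoneE !counitrE // counit1 // !scale1r.
Qed.

Section SkewAntipode.
Variable S : H -> H.
Hypothesis antS : is_antipode S.

Let cS := antipode_clinear antS.
Let SM := antipodeM biH antS.
Let S1 := antipode1 biH antS.

(** Applying x (x) y (x) z |-> S(x) y (x) z to (Delta (x) id)(R) = R_13 R_23 gives 1 = (S (x) id)(R)
    R. *)
Lemma antipodel_Rmatrix : tmap S id R = J.
Proof.
apply: (left_inverse_uniq algHH (x := R)); last exact: RJ.1.
have cSid := tmap_clinear cS (@id_clinear _ _ H).
pose mu (t : tens_alg H (tens_alg H H)) : tens_alg H H :=
  tlift (fun x s => tlift (fun y z => (S x ** y) \ox z) s) t.
have cmu : clinear mu by rewrite /mu; clin.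
have muE x y z : mu (x \ox (y \ox z)) = (S x ** y) \ox z by rewrite /mu; tsimp.
have mul (t : tens_alg H H) : mu (coprodl t) = aone \ox counitl t.
  ext_pure t x y; rewrite coprodlE // counitlE // pureZr -pureZl.
  rewrite -(sandwichl_coprod biH antS); ext_pure (coprod x) x1 x2.
  by rewrite tassocE muE sandwichlE // amul1r.
have muM (s t : tens_alg H H) :
    mu (leg13 s ** leg23 t) = (tmap S id s : tens_alg H H) ** t.
  ext_pure s x y; ext_pure t z w; rewrite leg13E /leg23 !tens_amulE // muE.
  by rewrite tmapE ?tens_amulE ?amul1l ?amul1r.
by rewrite -muM -Rl mul counitl_Rmatrix.
Qed.

(** The same argument in the second leg, starting from the inverted axiom (id (x) Delta)(J) = J_12
    J_13. *)
Lemma antipoder_inv_Rmatrix : tmap id S J = R.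
Proof.
apply: (left_inverse_uniq algHH (x := J)); last exact: RJ.2.
have cidS := tmap_clinear (@id_clinear _ _ H) cS.
pose mu (t : tens_alg H (tens_alg H H)) : tens_alg H H :=
  tlift (fun x s => tlift (fun y z => x \ox (S y ** z)) s) t.
have cmu : clinear mu by rewrite /mu; clin.
have muE x y z : mu (x \ox (y \ox z)) = x \ox (S y ** z) by rewrite /mu; tsimp.
have mur (t : tens_alg H H) : mu (coprodr t) = counitr t \ox aone.
  ext_pure t x y; rewrite coprodrE // counitrE // pureZl -pureZr.
  rewrite -(sandwichl_coprod biH antS); ext_pure (coprod y) y1 y2.
  by rewrite muE sandwichlE // amul1r.
have muM (s t : tens_alg H H) :
    mu (leg12 s ** leg13 t) = (tmap id S s : tens_alg H H) ** t.
  ext_pure s x y; ext_pure t z w; rewrite leg13E leg12E !tens_amulE // muE.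
  by rewrite tmapE ?tens_amulE ?amul1l ?amul1r.
rewrite -muM; have <- : coprodr J = leg12 J ** leg13 J.
  apply: (left_inverse_uniq algH3 (x := coprodr R)).
    exact: (alghom_inverse (coprodr_alghom biH) RJ).2.
  rewrite Rr; apply: (amul_inverse algH3 _ _).1.
    exact: (alghom_inverse (leg13_alghom algH) RJ).
  exact: (alghom_inverse (leg12_alghom algH) RJ).
have counitJ : counitr J = aone.
  have [e _] := alghom_inverse (counitr_alghom biH) RJ.
  by rewrite -e counitr_Rmatrix amul1l.
by rewrite mur counitJ.
Qed.

Lemma antipode_Rmatrix : tmap S S R = R.
Proof.
have cSid := tmap_clinear cS (@id_clinear _ _ H).
have cidS := tmap_clinear (@id_clinear _ _ H) cS.
rewrite -[RHS]antipoder_inv_Rmatrix -antipodel_Rmatrix.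
by ext_pure R x y; rewrite !tmapE.
Qed.

(* The Drinfeld element [S(R_2) R_1], which implements [S^2]; the skew antipode
   [S^-1] is then its conjugation of [S]. *)
Let u : H := sandwichl S aone (tflip R).
Let v : H := tlift (fun x y => y ** S (S x)) R.

Let flipM (s t : tens_alg H H) := alghomM s t (tflip_alghom algH algH).

(** The element u is 1 acted on by R_21, and R_21 Delta^op(x) = Delta(x) R_21; so Delta(x) meets the
    unit first and yields the counit. *)
Let u_flip x : sandwichl S u (tflip (coprod x)) = (counit x : K) *: u.
Proof.
rewrite /u -sandwichl_mul //.
have -> : (tflip R : tens_alg H H) ** tflip (coprod x) =
    (coprod x : tens_alg H H) ** tflip R.
  rewrite -flipM Rcoprod flipM; congr (_ ** _).
  by ext_pure (coprod x) x1 x2; rewrite !tflipE.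
by rewrite sandwichl_mul // sandwichl_coprod // sandwichlZ.
Qed.

(** Compute S^2(x_3) S(x_2) u x_1 in two ways: S^2(x_3) S(x_2) = S(x_2 S(x_3)) leaves u x, whereas
    [u_flip] applied to S(x_2) u x_1 leaves S^2(x) u. *)
Let u_conj x : S (S x) ** u = u ** x.
Proof.
pose mu (t : tens_alg H (tens_alg H H)) : H :=
  tlift (fun x s => tlift (fun y z => S (S z) ** S y ** u ** x) s) t.
have cmu : clinear mu by rewrite /mu; clin.
have muE y z w : mu (y \ox (z \ox w)) = S (S w) ** S z ** u ** y.
  by rewrite /mu; tsimp.
have [_ _ _ /(_ x) xA /(_ x)[xl xr]] := biH.
rewrite -[in LHS]xl -[in RHS]xr.
have -> : u ** counitr (coprod x) = mu (coprodr (coprod x)).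
  ext_pure (coprod x) y z; rewrite coprodrE // counitrE // amulZr //.
  have -> : mu (y \ox coprod z) = S (sandwichr S aone (coprod z)) ** u ** y.
    by ext_pure (coprod z) z1 z2; rewrite muE sandwichrE // amul1r // SM.
  by rewrite sandwichr_coprod // (clinearZ _ _ cS) S1 !amulZl // amul1l.
rewrite -xA; ext_pure (coprod x) y z; rewrite coprodlE // counitlE //.
have -> : mu (tassoc (coprod y \ox z)) = S (S z) ** sandwichl S u (tflip (coprod y)).
  ext_pure (coprod y) y1 y2; rewrite tassocE muE tflipE sandwichlE //.
  by rewrite !amulA.
by rewrite u_flip !(clinearZ _ _ cS) amulZl // amulZr.
Qed.

(** As (S (x) id)(R) = J, the left side is 1 acted on by R_21 and then by J_21. Both v u and u v
    reduce to this expression, through [u_conj] and the invariance of R under S (x) S. *)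
Let uR : tlift (fun x y => S y ** u ** S x) R = aone.
Proof.
have cSid := tmap_clinear cS (@id_clinear _ _ H).
have -> : tlift (fun x y => S y ** u ** S x) R = sandwichl S u (tflip (tmap S id R)).
  by ext_pure R x y; tsimp; rewrite tmapE // tflipE sandwichlE.
rewrite antipodel_Rmatrix /u -sandwichl_mul // -flipM RJ.1.
by rewrite (alghom1 (tflip_alghom algH algH)) sandwichl1.
Qed.

Let vu1 : v ** u = aone.
Proof.
have cSS := tmap_clinear cS cS.
rewrite -uR; have -> : v ** u = tlift (fun x y => y ** u ** x) R.
  by rewrite /v; ext_pure R x y; tsimp; rewrite -amulA // u_conj amulA.
by rewrite -[in LHS]antipode_Rmatrix; ext_pure R x y; rewrite tmapE //; tsimp.
Qed.

Let uv1 : u ** v = aone.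
Proof.
have cSS := tmap_clinear cS cS.
rewrite -uR -[in RHS]antipode_Rmatrix /v.
ext_pure R x y; rewrite tmapE //; tsimp.
by rewrite amulA // -u_conj.
Qed.

Let v_conj x : x ** v = v ** S (S x).
Proof.
rewrite -[x in LHS](amul1l algH) -vu1 -(amulA algH v) -u_conj.
by rewrite -!(amulA algH) uv1 amul1r.
Qed.

(** With v = u^-1, the first identity v S(x_2) u x_1 = eps(x) is [u_flip]. In the second, v is moved
    left past x_2 by [v_conj], and S^2(x_2) S(x_1) = S(x_1 S(x_2)) collapses. *)
Lemma quasitriangular_coopposite_antipode :
  @is_antipode _ _ (coopposite H) (fun x => v ** S x ** u).
Proof.
split; first by clin.
move=> x; split.
  change (tlift (fun y z : H => (v ** S y ** u) ** z) (tflip (coprod (x : H))) =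
    (counit (x : H) : K) *: (aone : H)).
  have -> : tlift (fun y z => (v ** S y ** u) ** z) (tflip (coprod (x : H))) =
      v ** sandwichl S u (tflip (coprod (x : H))).
    ext_pure (tflip (coprod (x : H))) y z; tsimp.
    by rewrite sandwichlE // !amulA.
  by rewrite u_flip amulZr // vu1.
change (tlift (fun y z : H => y ** (v ** S z ** u)) (tflip (coprod (x : H))) =
  (counit (x : H) : K) *: (aone : H)).
have -> : tlift (fun y z => y ** (v ** S z ** u)) (tflip (coprod (x : H))) =
    v ** S (sandwichr S aone (coprod (x : H))) ** u.
  ext_pure (coprod (x : H)) y z; rewrite tflipE; tsimp.
  rewrite sandwichrE // amul1r // SM.
  by rewrite !amulA // v_conj.
rewrite sandwichr_coprod // (clinearZ _ _ cS) S1 amulZr // amul1r //.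
by rewrite amulZl // vu1.
Qed.

End SkewAntipode.

End Quasitriangular.

Lemma coopposite_is_hopf (K : comNzRingType) (KT : ctopring K) (H : hopf KT)
  (R : tens_alg H H) : is_hopf H -> quasitriangular R -> is_hopf (coopposite H).
Proof.
move=> [biH [S antS]] qtR; split; first exact: coopposite_is_bialgebra.
by eexists; apply: (quasitriangular_coopposite_antipode biH qtR antS).
Qed.

(** * The Yang-Baxter equation and the cocycle *)

Section JoinedMorphisms.
Context {K : comNzRingType} {KT : ctopring K}.
Implicit Types A B C D : alg KT.

Lemma commuting_sym A B C (f : A -> C) (g : B -> C) :
  commuting f g -> commuting g f.
Proof. by move=> fg x y. Qed.

Lemma alghom_tjoin A B C D (phi : C -> D) (f : A -> C) (g : B -> C)
    (f' : A -> D) (g' : B -> D) t :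
  is_algebra C -> is_algebra D -> alghom phi -> clinear f -> clinear g ->
  clinear f' -> clinear g' ->
  phi \o f =1 f' -> phi \o g =1 g' -> phi (tjoin f g t) = tjoin f' g' t.
Proof.
move=> algC algD hphi cf cg cf' cg' ff' gg'; have cphi := alghom_clinear hphi.
have cj := tjoin_clinear algC cf cg; have cj' := tjoin_clinear algD cf' cg'.
by ext_pure t x y; rewrite !tjoinE // alghomM // -ff' -gg'.
Qed.

Lemma tjoin_commuting A B C D (f : A -> D) (g : B -> D) (h : C -> D) :
  is_algebra D -> clinear f -> clinear g -> clinear h ->
  commuting f h -> commuting g h -> commuting (tjoin f g) h.
Proof.
move=> algD cf cg ch fh gh t z; have cj := tjoin_clinear algD cf cg.
ext_pure t x y; rewrite tjoinE //.
by rewrite -amulA // gh amulA // fh amulA.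
Qed.

Lemma tjoin_flip A B C (f : A -> C) (g : B -> C) (t : tens_alg A B) :
  is_algebra C -> clinear f -> clinear g -> commuting f g ->
  tjoin g f (tflip t) = tjoin f g t.
Proof.
move=> algC cf cg fg; have cj := tjoin_clinear algC cf cg.
have cj' := tjoin_clinear algC cg cf.
by ext_pure t x y; rewrite tflipE !tjoinE.
Qed.

End JoinedMorphisms.

(* [R_{fg} = f(R_1) g(R_2)] for commuting morphisms f, g is [tjoin f g R]. *)
Section YangBaxter.
Context {K : comNzRingType} {KT : ctopring K} (H : hopf KT) (R : tens_alg H H).
Hypotheses (biH : is_bialgebra H) (qtR : quasitriangular R).
Variables (A : alg KT) (f g h : H -> A).
Hypotheses (algA : is_algebra A) (hf : alghom f) (hg : alghom g) (hh : alghom h).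
Hypotheses (fg : commuting f g) (fh : commuting f h) (gh : commuting g h).

Let algH : is_algebra H := bialgebra_algebra biH.
Let algHH : is_algebra (tens_alg H H) := tens_is_algebra algH algH.
Let cf := alghom_clinear hf.
Let cg := alghom_clinear hg.
Let ch := alghom_clinear hh.
Let hjgh := tjoin_alghom algH algH algA hg hh gh.
Let cjgh := alghom_clinear hjgh.
Let cjfg := tjoin_clinear algA cf cg.

Let f_jgh : commuting f (tjoin g h).
Proof.
by apply: commuting_sym; apply: tjoin_commuting => //; apply: commuting_sym.
Qed.

Let join3 : tens_alg H (tens_alg H H) -> A := tjoin f (tjoin g h).
Let hj3 : alghom join3 := tjoin_alghom algH algHH algA hf hjgh f_jgh.
Let cj3 := alghom_clinear hj3.

Let join3E x y z : join3 (x \ox (y \ox z)) = f x ** (g y ** h z).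
Proof. by rewrite /join3 !tjoinE. Qed.

Let join3_leg13 t : join3 (leg13 t) = tjoin f h t.
Proof.
have cj := tjoin_clinear algA cf ch; ext_pure t x y.
by rewrite leg13E join3E tjoinE // (alghom1 hg) amul1l.
Qed.

Let join3_leg12 t : join3 (leg12 t) = tjoin f g t.
Proof.
ext_pure t x y.
by rewrite leg12E join3E tjoinE // (alghom1 hh) amul1r.
Qed.

Let join3_leg23 t : join3 (leg23 t) = tjoin g h t.
Proof. by rewrite /join3 /leg23 tjoinE // (alghom1 hf) amul1l. Qed.

(** The image of the axiom (Delta (x) id)(R) = R_13 R_23 under the algebra morphism [join3]
    determined by the commuting legs [f], [g], [h]. *)
Lemma tjoin_coprodl :
  tjoin (fun x => tjoin f g (coprod x)) h R = tjoin f h R ** tjoin g h R.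
Proof.
have [_ Rl _ _] := qtR.
rewrite -join3_leg13 -join3_leg23 -(alghomM _ _ hj3) -Rl.
have cfgD : clinear (fun x => tjoin f g (coprod x)) by clin.
have cj := tjoin_clinear algA cfgD ch.
ext_pure R x y; rewrite tjoinE // coprodlE //.
ext_pure (coprod x) x1 x2.
by rewrite tassocE join3E tjoinE // amulA.
Qed.

Lemma tjoin_coprodr :
  tjoin f (fun x => tjoin g h (coprod x)) R = tjoin f h R ** tjoin f g R.
Proof.
have [_ _ Rr _] := qtR.
rewrite -join3_leg13 -join3_leg12 -(alghomM _ _ hj3) -Rr.
have cghD : clinear (fun x => tjoin g h (coprod x)) by clin.
have cj := tjoin_clinear algA cf cghD.
ext_pure R x y; rewrite tjoinE // coprodrE //.
ext_pure (coprod y) y1 y2.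
by rewrite join3E tjoinE.
Qed.

Lemma tjoin_Rcoprod x :
  tjoin f g R ** tjoin f g (coprod x) = tjoin g f (coprod x) ** tjoin f g R.
Proof.
have [_ _ _ Rc] := qtR; have hj := tjoin_alghom algH algH algA hf hg fg.
rewrite -(alghomM _ _ hj) Rc (alghomM _ _ hj); congr (_ ** _).
by rewrite tjoin_flip //; apply: commuting_sym.
Qed.

End YangBaxter.

(** The product R_fh R_gh is (Delta (x) id)(R) in these legs; moving R_fg past it turns Delta into
    Delta^op, which gives R_gh R_fh. *)
Lemma yang_baxter (K : comNzRingType) (KT : ctopring K) (H : hopf KT)
    (R : tens_alg H H) (A : alg KT) (f g h : H -> A) :
  is_bialgebra H -> quasitriangular R -> is_algebra A ->
  alghom f -> alghom g -> alghom h ->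
  commuting f g -> commuting f h -> commuting g h ->
  tjoin f g R ** (tjoin f h R ** tjoin g h R) =
  tjoin g h R ** tjoin f h R ** tjoin f g R.
Proof.
move=> biH qtR algA hf hg hh fg fh gh; have gf := commuting_sym fg.
have cf := alghom_clinear hf; have cg := alghom_clinear hg.
have ch := alghom_clinear hh.
have cjfg := tjoin_clinear algA cf cg; have cjgf := tjoin_clinear algA cg cf.
rewrite -tjoin_coprodl // -(tjoin_coprodl biH qtR algA hg hf hh) //.
have cfgD : clinear (fun x => tjoin f g (coprod x)) by clin.
have cgfD : clinear (fun x => tjoin g f (coprod x)) by clin.
have cj := tjoin_clinear algA cfgD ch; have cj' := tjoin_clinear algA cgfD ch.
have fg_h := tjoin_commuting algA cf cg ch fh gh.
suff e (t : tens_alg H H) :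
    tjoin f g R ** tjoin (fun x => tjoin f g (coprod x)) h t =
    tjoin (fun x => tjoin g f (coprod x)) h t ** tjoin f g R by apply: e.
ext_pure t x y; rewrite !tjoinE // amulA // tjoin_Rcoprod //.
by rewrite -!amulA // fg_h.
Qed.

(** * The cocycle and the twist it defines *)

Section Cocycle.
Context {K : comNzRingType} {KT : ctopring K} (H : hopf KT) (R : tens_alg H H).
Hypotheses (biH : is_bialgebra H) (qtR : quasitriangular R).

Let HopH : hopf KT := tens_hopf (coopposite H) H.
Let B : alg KT := tens_alg H H.

Let algH : is_algebra H := bialgebra_algebra biH.
Let algB : is_algebra B := tens_is_algebra algH algH.
Let algBB : is_algebra (tens_alg B B) := tens_is_algebra algB algB.
Let algB3 : is_algebra (tens_alg B (tens_alg B B)) := tens_is_algebra algB algBB.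
Let bicop : is_bialgebra (coopposite H) := coopposite_is_bialgebra biH.
Let biHopH : is_bialgebra HopH := tens_is_bialgebra bicop biH.

Let a (x : H) : B := x \ox aone.
Let b (x : H) : B := aone \ox x.
(** The maps [a1], [b1], [a2] are legs 1, 2, 3 of the fourfold tensor power of H. *)
Let a1 (x : H) : tens_alg B B := a x \ox aone.
Let b1 (x : H) : tens_alg B B := b x \ox aone.
Let a2 (x : H) : tens_alg B B := aone \ox a x.

Let ha : alghom a := inl_alghom algH algH.
Let hb : alghom b := inr_alghom algH algH.
Let ha1 : alghom a1 := alghom_comp (inl_alghom algB algB) ha.
Let hb1 : alghom b1 := alghom_comp (inl_alghom algB algB) hb.
Let ha2 : alghom a2 := alghom_comp (inr_alghom algB algB) ha.

(* The cocycle [R_13 R_23] on [(H^op (x) H) (x) (H^op (x) H)]. *)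
Definition coopposite_cocycle : tens_alg HopH HopH := tjoin a1 a2 R ** tjoin b1 a2 R.

Let a1a2 : commuting a1 a2.
Proof. by move=> x y; rewrite !tens_amulE // !amul1l // !amul1r. Qed.
Let b1a2 : commuting b1 a2.
Proof. by move=> x y; rewrite !tens_amulE // !amul1l // !amul1r. Qed.

Let hP : alghom (tjoin a1 a2) := tjoin_alghom algH algH algBB ha1 ha2 a1a2.
Let hG : alghom (tjoin b1 a2) := tjoin_alghom algH algH algBB hb1 ha2 b1a2.

Let RJ : is_inverse R (ainv R). Proof. by apply: ainvP; case: qtR. Qed.
Let PV := alghom_inverse hP RJ.
Let GV := alghom_inverse hG RJ.
Let FV := amul_inverse algBB PV GV.

(** The maps [c1], [d1], [c2], [d2], [c3] are, in this order, legs 1 to 5 of the sixfold tensor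
    power of H. *)
Let c1 (x : H) : tens_alg B (tens_alg B B) := a x \ox aone.
Let d1 (x : H) : tens_alg B (tens_alg B B) := b x \ox aone.
Let c2 (x : H) : tens_alg B (tens_alg B B) := aone \ox a1 x.
Let d2 (x : H) : tens_alg B (tens_alg B B) := aone \ox b1 x.
Let c3 (x : H) : tens_alg B (tens_alg B B) := aone \ox a2 x.

Let hc1 : alghom c1 := alghom_comp (inl_alghom algB algBB) ha.
Let hd1 : alghom d1 := alghom_comp (inl_alghom algB algBB) hb.
Let hc2 : alghom c2 := alghom_comp (inr_alghom algB algBB) ha1.
Let hd2 : alghom d2 := alghom_comp (inr_alghom algB algBB) hb1.
Let hc3 : alghom c3 := alghom_comp (inr_alghom algB algBB) ha2.

Ltac commute := by move=> x y; rewrite !tens_amulE // !amul1l // !amul1r.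

Let c1c2 : commuting c1 c2. Proof. commute. Qed.
Let c1c3 : commuting c1 c3. Proof. commute. Qed.
Let c2c3 : commuting c2 c3. Proof. commute. Qed.
Let d1c2 : commuting d1 c2. Proof. commute. Qed.
Let d1c3 : commuting d1 c3. Proof. commute. Qed.
Let d2c3 : commuting d2 c3. Proof. commute. Qed.
Let d1d2 : commuting d1 d2. Proof. commute. Qed.
Let d1c1 : commuting d1 c1. Proof. commute. Qed.
Let d2c1 : commuting d2 c1. Proof. commute. Qed.
Let d2c2 : commuting d2 c2. Proof. commute. Qed.

Let coprod1 := alghom1 (coprod_alghom biH).
Let coprodHopHE := tens_coprodE bicop biH.

(** The first factor of H^op (x) H carries the opposite coproduct, hence the reversed order [c2],
    [c1]; the same happens in [coprodr_a2], but not in [coprodl_b1]. *)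
Let coprodl_a1 x : @coprodl _ _ HopH (a1 x) = tjoin c2 c1 (coprod x).
Proof.
have cj := tjoin_clinear algB3 (alghom_clinear hc2) (alghom_clinear hc1).
rewrite (coprodlE _ _ biHopH) coprodHopHE coprod1.
rewrite -[@coprod _ _ (coopposite H) x]/(tflip (coprod x)) tens_aoneE.
ext_pure (coprod x) x1 x2.
rewrite tflipE tmidflipE tassocE tjoinE ?tens_amulE ?amul1l ?amul1r //;
  exact: alghom_clinear.
Qed.

Let coprodl_b1 x : @coprodl _ _ HopH (b1 x) = tjoin d1 d2 (coprod x).
Proof.
have cj := tjoin_clinear algB3 (alghom_clinear hd1) (alghom_clinear hd2).
rewrite (coprodlE _ _ biHopH) coprodHopHE.
rewrite -[@coprod _ _ (coopposite H) aone]/(tflip (coprod (aone : H))) coprod1.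
rewrite tens_aoneE tflipE; ext_pure (coprod x) x1 x2.
rewrite tmidflipE tassocE tjoinE ?tens_amulE ?amul1l ?amul1r //;
  exact: alghom_clinear.
Qed.

Let coprodl_a2 x : @coprodl _ _ HopH (a2 x) = c3 x.
Proof.
rewrite (coprodlE _ _ biHopH) (alghom1 (coprod_alghom biHopH)).
by rewrite tens_aoneE tassocE.
Qed.

Let coprodr_a1 x : @coprodr _ _ HopH (a1 x) = c1 x.
Proof. by rewrite (coprodrE _ _ biHopH) (alghom1 (coprod_alghom biHopH)). Qed.

Let coprodr_b1 x : @coprodr _ _ HopH (b1 x) = d1 x.
Proof. by rewrite (coprodrE _ _ biHopH) (alghom1 (coprod_alghom biHopH)). Qed.

Let coprodr_a2 x : @coprodr _ _ HopH (a2 x) = tjoin c3 c2 (coprod x).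
Proof.
have cj := tjoin_clinear algB3 (alghom_clinear hc3) (alghom_clinear hc2).
rewrite (coprodrE _ _ biHopH) coprodHopHE coprod1.
rewrite -[@coprod _ _ (coopposite H) x]/(tflip (coprod x)) tens_aoneE.
ext_pure (coprod x) x1 x2.
rewrite tflipE tmidflipE tjoinE ?tens_amulE ?amul1l ?amul1r //;
  exact: alghom_clinear.
Qed.

Let counitHopHE := @tens_counitE _ _ (coopposite H) H bicop biH.

Let counitl_F : @counitl _ _ HopH coopposite_cocycle = aone.
Proof.
have hl := counitl_alghom biHopH; rewrite (alghomM _ _ hl).
have ca := alghom_clinear ha.
have e f : alghom f -> (forall x, @counitl _ _ HopH (f x) = (counit x : K) *: aone) ->
    @counitl _ _ HopH (tjoin f a2 R) = aone.
  move=> hf fE; rewrite -(alghom1 ha) -(counitl_Rmatrix biH qtR).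
  have cf := alghom_clinear hf; have cg := alghom_clinear ha2.
  have cj := tjoin_clinear algBB cf cg; have cl := alghom_clinear hl.
  ext_pure R x y; rewrite tjoinE // (alghomM _ _ hl) fE (counitlE _ _ biH).
  rewrite (counitlE _ _ biHopH) (counit1 biHopH) scale1r (clinearZ _ _ ca).
  by rewrite amulZl // amul1l.
rewrite !e // ?amul1l // => x.
  by rewrite (counitlE _ _ biHopH) counitHopHE (counit1 biH) mul1r.
by rewrite (counitlE _ _ biHopH) counitHopHE (counit1 biH) mulr1.
Qed.

Let counitr_F : @counitr _ _ HopH coopposite_cocycle = aone.
Proof.
have hr := counitr_alghom biHopH; rewrite (alghomM _ _ hr).
have e (f : H -> tens_alg B B) (f' : H -> B) : alghom f -> alghom f' ->
    (forall x, @counitr _ _ HopH (f x) = f' x) ->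
    @counitr _ _ HopH (tjoin f a2 R) = aone.
  move=> hf hf' fE; rewrite -(alghom1 hf') -(counitr_Rmatrix biH qtR).
  have cf := alghom_clinear hf; have cg := alghom_clinear ha2.
  have cf' := alghom_clinear hf'.
  have cj := tjoin_clinear algBB cf cg; have cl := alghom_clinear hr.
  ext_pure R x y; rewrite tjoinE // (alghomM _ _ hr) fE (counitrE _ _ biH).
  rewrite (counitrE _ _ biHopH) counitHopHE (counit1 biH) mulr1 (clinearZ _ _ cf').
  by rewrite amulZr // amul1r.
have er x : @counitr _ _ HopH (x \ox aone) = x.
  by rewrite (counitrE _ _ biHopH) (counit1 biHopH) scale1r.
rewrite (e a1 a ha1 ha (fun x => er (a x))) (e b1 b hb1 hb (fun x => er (b x))).
by rewrite amul1l.
Qed.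

Let tjoin2_commuting (f g f' g' : H -> tens_alg B (tens_alg B B)) s t :
  alghom f -> alghom g -> alghom f' -> alghom g' ->
  commuting f f' -> commuting f g' -> commuting g f' -> commuting g g' ->
  tjoin f g s ** tjoin f' g' t = tjoin f' g' t ** tjoin f g s.
Proof.
move=> hf hg hf' hg' ff' fg' gf' gg'.
have cf := alghom_clinear hf; have cg := alghom_clinear hg.
have cf' := alghom_clinear hf'; have cg' := alghom_clinear hg'.
apply: tjoin_commuting => //; first exact: tjoin_clinear.
  by apply: commuting_sym; apply: tjoin_commuting => //; apply: commuting_sym.
by apply: commuting_sym; apply: tjoin_commuting => //; apply: commuting_sym.
Qed.

Let coprodl_F : @coprodl _ _ HopH coopposite_cocycle =
  (tjoin c2 c3 R ** tjoin c1 c3 R) ** (tjoin d1 c3 R ** tjoin d2 c3 R).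
Proof.
have hl := coprodl_alghom biHopH; rewrite (alghomM _ _ hl).
have [ca1 cb1 ca2] : [/\ clinear a1, clinear b1 & clinear a2].
  by split; apply: alghom_clinear.
have [cc1 cc2 cc3] : [/\ clinear c1, clinear c2 & clinear c3].
  by split; apply: alghom_clinear.
have [cd1 cd2] : clinear d1 /\ clinear d2 by split; apply: alghom_clinear.
have cjc := tjoin_clinear algB3 cc2 cc1; have cjd := tjoin_clinear algB3 cd1 cd2.
have c2c1 := commuting_sym c1c2.
rewrite -(tjoin_coprodl biH qtR algB3 hc2 hc1 hc3) //.
rewrite -(tjoin_coprodl biH qtR algB3 hd1 hd2 hc3) //.
by congr (_ ** _); apply: alghom_tjoin => //; clin.
Qed.

Let coprodr_F : @coprodr _ _ HopH coopposite_cocycle =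
  (tjoin c1 c2 R ** tjoin c1 c3 R) ** (tjoin d1 c2 R ** tjoin d1 c3 R).
Proof.
have hr := coprodr_alghom biHopH; rewrite (alghomM _ _ hr).
have [ca1 cb1 ca2] : [/\ clinear a1, clinear b1 & clinear a2].
  by split; apply: alghom_clinear.
have [cc1 cc2 cc3] : [/\ clinear c1, clinear c2 & clinear c3].
  by split; apply: alghom_clinear.
have cd1 : clinear d1 by apply: alghom_clinear.
have cjc := tjoin_clinear algB3 cc3 cc2.
have c3c2 := commuting_sym c2c3.
rewrite -(tjoin_coprodr biH qtR algB3 hc1 hc3 hc2) //.
rewrite -(tjoin_coprodr biH qtR algB3 hd1 hc3 hc2) //.
by congr (_ ** _); apply: alghom_tjoin => //; clin.
Qed.

Let leg12_F : leg12 coopposite_cocycle = tjoin c1 c2 R ** tjoin d1 c2 R.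
Proof.
have hl := leg12_alghom algB; rewrite (alghomM _ _ hl).
by congr (_ ** _); apply: alghom_tjoin => //; try exact: alghom_clinear;
  move=> x; apply: leg12E.
Qed.

Let leg23_F : leg23 coopposite_cocycle = tjoin c2 c3 R ** tjoin d2 c3 R.
Proof.
have hl := leg23_alghom algB; rewrite (alghomM _ _ hl).
by congr (_ ** _); apply: alghom_tjoin => //; exact: alghom_clinear.
Qed.

Lemma coopposite_cocycleP : twisting_cocycle coopposite_cocycle.
Proof.
split; [by exists (tjoin b1 a2 (ainv R) ** tjoin a1 a2 (ainv R))| |by split].
rewrite coprodl_F coprodr_F leg12_F leg23_F.
have YBc := yang_baxter biH qtR algB3 hc1 hc2 hc3 c1c2 c1c3 c2c3.
have YBd := yang_baxter biH qtR algB3 hd1 hc2 hc3 d1c2 d1c3 c2c3.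
have [c1d1 c1d2] := (commuting_sym d1c1, commuting_sym d2c1).
have [c2d1 c2d2] := (commuting_sym d1c2, commuting_sym d2c2).
have Cmq := tjoin2_commuting R R hc1 hc2 hd1 hc3 c1d1 c1c3 c2d1 c2c3.
have Cmr := tjoin2_commuting R R hc1 hc2 hd2 hc3 c1d2 c1c3 c2d2 c2c3.
have Cnr := tjoin2_commuting R R hd1 hc2 hd2 hc3 d1d2 d1c3 c2d2 c2c3.
move: (tjoin c2 c3 R) (tjoin c1 c3 R) (tjoin d1 c3 R) (tjoin d2 c3 R)
  (tjoin c1 c2 R) (tjoin d1 c2 R) YBc YBd Cmq Cmr Cnr => s p q r m n.
move=> mps nqs mq mr nr; have mulA := amulA algB3.
(* In letters: s p q r m n = s p m q n r by disjointness of legs, = m p s q n r by the first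
   Yang-Baxter equation, = m p n q s r by the second. *)
rewrite -!mulA (mulA r) -mr -(mulA m) -nr (mulA q) -mq -!mulA.
rewrite (mulA s) (mulA _ m) -mps -!mulA; congr (_ ** (_ ** _)).
by rewrite (mulA s) (mulA (s ** q)) -nqs -!mulA.
Qed.

Lemma twist_coopposite_coprod :
  @coprod _ _ (twist coopposite_cocycle) = @coprod _ _ (twisted_square R).
Proof.
set G : tens_alg (tens_hopf H H) (tens_hopf H H) :=
  tlift (fun x y => (aone \ox x) \ox (y \ox aone)) R.
have GE : G = tjoin b1 a2 R.
  by apply: eq_tlift => x y; rewrite tens_amulE // amul1l // amul1r.
have coprodP (x : B) : @coprod _ _ HopH x ** tjoin a1 a2 R =
    tjoin a1 a2 R ** @coprod _ _ (tens_hopf H H) x.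
  have biHH := tens_is_bialgebra biH biH.
  have c := coprod_clinear biHopH; have c' := coprod_clinear biHH.
  ext_pure x y z; rewrite coprodHopHE tens_coprodE //.
  rewrite -[@coprod _ _ (coopposite H) y]/(tflip (coprod y)).
  (* Before the middle flip, R_13 is R acting on the coproduct of the first factor alone, where the
     quasitriangularity axiom applies. *)
  have -> : tjoin a1 a2 R = tmidflip (R \ox (aone : tens_alg H H)).
    have cj := alghom_clinear hP; ext_pure R u v.
    rewrite tens_aoneE tmidflipE tjoinE ?tens_amulE ?amul1l ?amul1r //;
      exact: alghom_clinear.
  have hm := tmidflip_alghom algH algH algH algH.
  have algHH := tens_is_algebra algH algH.
  rewrite -!(alghomM _ _ hm) !tens_amulE // amul1l // amul1r //.
  by have [_ _ _ ->] := qtR.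
apply/funext => x.
rewrite -[LHS]/(ainv coopposite_cocycle ** @coprod _ _ HopH x ** coopposite_cocycle).
rewrite -[RHS]/(ainv G ** @coprod _ _ (tens_hopf H H) x ** G).
rewrite (ainv_eq algBB FV) GE (ainv_eq algBB GV) /coopposite_cocycle.
rewrite -!(amulA algBB); congr (_ ** _).
rewrite (amulA algBB (@coprod _ _ HopH x)) coprodP -(amulA algBB) (amulA algBB).
by rewrite PV.2 amul1l.
Qed.

Lemma twist_coopposite_cocycle : twist coopposite_cocycle = twisted_square R.
Proof.
exact: (congr1 (fun c => @Hopf K KT B c (@counit _ _ HopH)) twist_coopposite_coprod).
Qed.

End Cocycle.

Theorem theorem4p9 (k : fieldType) (chark0 : [pchar k]%R =i pred0)
    (K : comAlgType k) (KT : ctopring K) (H : hopf KT) (R : tens_alg H H)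
    (hopfH : is_hopf H) (qtR : quasitriangular R) :
  let HopH : hopf KT := tens_hopf (coopposite H) H in
  is_hopf HopH /\ is_hopf (twisted_square R) /\
  exists F : tens_alg HopH HopH,
    twisting_cocycle F /\
    twist F = twisted_square R /\
    forall (A : alg KT) (act : HopH -> A -> A),
      is_module_algebra act ->
      @is_module_algebra K KT (twisted_square R) (twist_alg F act) act.
Proof.
have biH := hopfH.1; have hopfop := coopposite_is_hopf hopfH qtR.
move=> HopH; have hopfHopH : is_hopf HopH := tens_is_hopf hopfop hopfH.
have cocF := coopposite_cocycleP biH qtR.
have twistE := twist_coopposite_cocycle biH qtR.
split=> //; split; first by rewrite -twistE; apply: twist_is_hopf.
exists (coopposite_cocycle R); split=> //; split=> // A act modA.
(* The two Hopf algebras have the same underlying algebra and counit by conversion, so only the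
   axiom involving the coproduct has to be rewritten. *)
have [algA bact act1M actM actunit] := twist_is_module_algebra hopfHopH.1 cocF modA.
have coprodE := twist_coopposite_coprod biH qtR.
by split=> // x a b; rewrite actM coprodE.
Qed.
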